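(* Let $R$ be a hensel valuation ring of finite rank and let $R\to A$ be a finite faithfully flat algebra. Then there exists an $A$-algebra $A'$ such that $R\to A'$ is finite and faithfully flat, and such that $\operatorname{Spec}(\widetilde{A'})\to\operatorname{Spec}(A')$ induces an isomorphism on underlying topological spaces and on all residue fields, where $\widetilde{A'}$ is the normalisation of $A'$.
   Context: A hensel valuation ring is a valuation ring that is henselian; its rank is its Krull dimension (fields are allowed). The normalisation $\widetilde{A}$ of a (not necessarily reduced) ring $A$ with finitely many minimal primes is the integral closure of the associated reduced ring $A^{\mathrm{red}}$ in the total ring of fractions $Q(A^{\mathrm{red}})$. *)

(* Defs.v *)
(* MathComp, with the classical axioms and the topology of MathComp-Analysis *)
From HB Require Import structures.
From mathcomp Require Import all_boot all_order all_algebra ring.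
From mathcomp Require Import mathcomp_extra boolp classical_sets.
From mathcomp Require Import topology_structure.

Set Implicit Arguments.
Unset Strict Implicit.
Unset Printing Implicit Defensive.

Import GRing.Theory.

Local Open Scope ring_scope.
Local Open Scope quotient_scope.

(** * Total ring of fractions *)

Section TotalFractions.
Variable A : comNzRingType.

Definition tratio := {x : A * A | `[<GRing.lreg x.2>]}.

Lemma tratioP (x : tratio) : GRing.lreg (val x).2.
Proof. by apply/asboolP; exact: (valP x). Qed.

Definition mk_tratio (a s : A) (reg_s : GRing.lreg s) : tratio :=
  exist _ (a, s) (introT (asboolP (GRing.lreg (a, s).2)) reg_s).

(* No further multiplier is needed: the denominators are non-zero-divisors. *)
Definition tratio_eq (x y : tratio) : bool :=
  (val x).1 * (val y).2 == (val y).1 * (val x).2.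

Lemma tratio_eq_refl : reflexive tratio_eq.
Proof. by move=> x; rewrite /tratio_eq. Qed.

Lemma tratio_eq_sym : symmetric tratio_eq.
Proof. by move=> x y; rewrite /tratio_eq eq_sym. Qed.

Lemma tratio_eq_trans : transitive tratio_eq.
Proof.
move=> y x z /eqP xy /eqP yz; apply/eqP; apply: (@tratioP y).
by rewrite mulrA [_ * (val x).1]mulrC xy mulrAC yz mulrAC mulrC.
Qed.

Canonical tratio_equiv :=
  EquivRel tratio_eq tratio_eq_refl tratio_eq_sym tratio_eq_trans.

Definition total_fractions := {eq_quot tratio_eq}.
Local Notation Q := total_fractions.

HB.instance Definition _ : EqQuotient _ tratio_eq Q := EqQuotient.on Q.
HB.instance Definition _ := Choice.on Q.

Definition tfrac (a s : A) (reg_s : GRing.lreg s) : Q :=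
  \pi_Q (mk_tratio a reg_s).

Lemma tfrac_eqP a s reg_s b t reg_t :
  @tfrac a s reg_s = @tfrac b t reg_t <-> a * t = b * s.
Proof. by split=> [/eqmodP/eqP|h] //; apply/eqmodP/eqP. Qed.

Lemma tfrac_ex (x : Q) : exists a s reg_s, x = @tfrac a s reg_s.
Proof.
elim/quotW: x => x; exists (val x).1, (val x).2, (@tratioP x).
by apply/eqmodP; rewrite /= /tratio_eq.
Qed.

Lemma repr_tfrac a s reg_s : let y := val (repr (@tfrac a s reg_s)) in
  y.1 * s = a * y.2.
Proof.
by apply/eqP; have /eqmodP := reprK (@tfrac a s reg_s); rewrite /= /tratio_eq.
Qed.

Let num (x : Q) := (val (repr x)).1.
Let den (x : Q) := (val (repr x)).2.
Let denP (x : Q) : GRing.lreg (den x). Proof. exact: tratioP. Qed.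

Definition tadd (x y : Q) : Q :=
  tfrac (num x * den y + num y * den x) (lregM (@denP x) (@denP y)).
Definition topp (x : Q) : Q := tfrac (- num x) (@denP x).
Definition tmul (x y : Q) : Q :=
  tfrac (num x * num y) (lregM (@denP x) (@denP y)).

Lemma taddE a s reg_s b t reg_t :
  tadd (@tfrac a s reg_s) (@tfrac b t reg_t) =
  tfrac (a * t + b * s) (lregM reg_s reg_t).
Proof.
apply/tfrac_eqP; rewrite /num /den.
have /= := @repr_tfrac a s reg_s; have /= := @repr_tfrac b t reg_t.
case: (val (repr _)) => b' t' /= hb; case: (val (repr _)) => a' s' /= ha.
transitivity ((a' * s) * t' * t + (b' * t) * s' * s); first by ring.
by rewrite ha hb; ring.
Qed.

Lemma toppE a s reg_s : topp (@tfrac a s reg_s) = tfrac (- a) reg_s.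
Proof.
by apply/tfrac_eqP; rewrite !mulNr; congr (- _); exact: repr_tfrac.
Qed.

Lemma tmulE a s reg_s b t reg_t :
  tmul (@tfrac a s reg_s) (@tfrac b t reg_t) =
  tfrac (a * b) (lregM reg_s reg_t).
Proof.
apply/tfrac_eqP; rewrite mulrACA [RHS]mulrACA.
by congr (_ * _); exact: repr_tfrac.
Qed.

Definition to_total_fractions (a : A) : Q := tfrac a (@lreg1 A).
Local Notation "a %:T" := (to_total_fractions a).

Lemma taddA : associative tadd.
Proof.
move=> x y z; have [a [s [? ->]]] := tfrac_ex x.
have [b [t [? ->]]] := tfrac_ex y; have [c [u [? ->]]] := tfrac_ex z.
by rewrite !taddE; apply/tfrac_eqP; ring.
Qed.

Lemma taddC : commutative tadd.
Proof.
move=> x y; have [a [s [? ->]]] := tfrac_ex x.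
have [b [t [? ->]]] := tfrac_ex y.
by rewrite !taddE; apply/tfrac_eqP; ring.
Qed.

Lemma tadd0 : left_id 0%:T tadd.
Proof.
move=> x; have [a [s [? ->]]] := tfrac_ex x.
by rewrite !taddE; apply/tfrac_eqP; ring.
Qed.

Lemma taddN : left_inverse 0%:T topp tadd.
Proof.
move=> x; have [a [s [? ->]]] := tfrac_ex x.
by rewrite toppE taddE; apply/tfrac_eqP; ring.
Qed.

HB.instance Definition _ := GRing.isZmodule.Build Q taddA taddC tadd0 taddN.

Lemma tmulA : associative tmul.
Proof.
move=> x y z; have [a [s [? ->]]] := tfrac_ex x.
have [b [t [? ->]]] := tfrac_ex y; have [c [u [? ->]]] := tfrac_ex z.
by rewrite !tmulE; apply/tfrac_eqP; ring.
Qed.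

Lemma tmulC : commutative tmul.
Proof.
move=> x y; have [a [s [? ->]]] := tfrac_ex x.
have [b [t [? ->]]] := tfrac_ex y.
by rewrite !tmulE; apply/tfrac_eqP; ring.
Qed.

Lemma tmul1 : left_id 1%:T tmul.
Proof.
move=> x; have [a [s [? ->]]] := tfrac_ex x.
by rewrite !tmulE; apply/tfrac_eqP; ring.
Qed.

Lemma tmulDl : left_distributive tmul tadd.
Proof.
move=> x y z; have [a [s [? ->]]] := tfrac_ex x.
have [b [t [? ->]]] := tfrac_ex y; have [c [u [? ->]]] := tfrac_ex z.
by rewrite !(taddE, tmulE); apply/tfrac_eqP; ring.
Qed.

Lemma tone_neq0 : 1%:T != 0%:T.
Proof.
by apply/eqP => /tfrac_eqP; rewrite !mulr1 => /eqP; rewrite oner_eq0.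
Qed.

HB.instance Definition _ :=
  GRing.Zmodule_isComNzRing.Build Q tmulA tmulC tmul1 tmulDl tone_neq0.

Lemma to_total_fractions_zmod_morphism : zmod_morphism to_total_fractions.
Proof.
move=> a b; rewrite /to_total_fractions -[RHS]/(tadd _ (topp _)) toppE taddE.
by apply/tfrac_eqP; ring.
Qed.

Lemma to_total_fractions_monoid_morphism : monoid_morphism to_total_fractions.
Proof.
split=> // a b; rewrite /to_total_fractions -[RHS]/(tmul _ _) tmulE.
by apply/tfrac_eqP; ring.
Qed.

HB.instance Definition _ := GRing.isZmodMorphism.Build A Q
  to_total_fractions to_total_fractions_zmod_morphism.
HB.instance Definition _ := GRing.isMonoidMorphism.Build A Q
  to_total_fractions to_total_fractions_monoid_morphism.

End TotalFractions.

Section TotalFractionsMap.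
Variables (A B : comNzRingType) (f : {rmorphism A -> B}).
Hypothesis f_lreg : forall s, GRing.lreg s -> GRing.lreg (f s).

Definition total_fractions_map (x : total_fractions A) : total_fractions B :=
  tfrac (f (val (repr x)).1) (f_lreg (@tratioP _ (repr x))).

Lemma total_fractions_mapE a s (reg_s : GRing.lreg s) :
  total_fractions_map (tfrac a reg_s) = tfrac (f a) (f_lreg reg_s).
Proof.
by apply/tfrac_eqP; rewrite -!rmorphM; congr (f _); exact: repr_tfrac.
Qed.

Lemma total_fractions_map_zmod_morphism : zmod_morphism total_fractions_map.
Proof.
move=> x y; have [a [s [? ->]]] := tfrac_ex x.
have [b [t [? ->]]] := tfrac_ex y.
rewrite -[LHS]/(total_fractions_map (tadd _ (topp _))) toppE taddE.
rewrite !total_fractions_mapE -[RHS]/(tadd _ (topp _)) toppE taddE.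
by apply/tfrac_eqP; rewrite !(rmorphD, rmorphN, rmorphM, mulNr).
Qed.

Lemma total_fractions_map_monoid_morphism :
  monoid_morphism total_fractions_map.
Proof.
split; first by rewrite total_fractions_mapE; apply/tfrac_eqP; rewrite rmorph1.
move=> x y; have [a [s [? ->]]] := tfrac_ex x.
have [b [t [? ->]]] := tfrac_ex y.
rewrite -[LHS]/(total_fractions_map (tmul _ _)) tmulE.
rewrite !total_fractions_mapE -[RHS]/(tmul _ _) tmulE.
by apply/tfrac_eqP; rewrite !rmorphM.
Qed.

HB.instance Definition _ :=
  GRing.isZmodMorphism.Build (total_fractions A) (total_fractions B)
    total_fractions_map total_fractions_map_zmod_morphism.
HB.instance Definition _ :=
  GRing.isMonoidMorphism.Build (total_fractions A) (total_fractions B)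
    total_fractions_map total_fractions_map_monoid_morphism.

End TotalFractionsMap.

(** * Prime spectrum and residue fields *)

Section Spec.
Variable A : comNzRingType.

(* Boolean predicates lose no ideal, since membership is classically decidable;
   [idealr_closed] includes properness. *)
Record spec := Spec {
  spec_pred : A -> bool;
  spec_idealr : idealr_closed spec_pred;
  spec_prime : prime_idealr_closed spec_pred
}.

HB.instance Definition _ (p : spec) :=
  isIdealr.Build A (spec_pred p) (spec_idealr p).
HB.instance Definition _ (p : spec) :=
  isPrimeIdealrClosed.Build A (spec_pred p) (@spec_prime p).

Definition spec_prime_idealr (p : spec) : prime_idealr A :=
  PrimeIdealr.clone A (spec_pred p) _.
Coercion spec_prime_idealr : spec >-> prime_idealr.

Lemma spec_inj (p q : spec) : spec_pred p =1 spec_pred q -> p = q.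
Proof.
case: p q => [P Pi Pp] [Q Qi Qp] /funext /= PQ.
have {}PQ : P = Q := PQ; case: _ / PQ in Qi Qp *.
by congr Spec; exact: Prop_irrelevance.
Qed.

HB.instance Definition _ := gen_eqMixin spec.
HB.instance Definition _ := gen_choiceMixin spec.

Definition zariski_open : set_system spec :=
  [set U | exists E : set A, U = [set p : spec | exists2 a, E a & a \notin spec_pred p]]%classic.

Lemma zariski_openT : zariski_open setT.
Proof.
exists [set 1]%classic; apply/seteqP; split=> // p _ /=.
by exists 1 => //; rewrite idealr1.
Qed.

Lemma zariski_openI : setI_closed zariski_open.
Proof.
move=> _ _ [E ->] [F ->].
exists [set x | exists2 a, E a & exists2 b, F b & x = a * b]%classic.
apply/seteqP; split=> p /=.
  move=> [[a Ea ap] [b Fb bp]]; exists (a * b); first by exists a => //; exists b.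
  by rewrite prime_idealrM negb_or ap.
move=> [_ [a Ea [b Fb ->]]]; rewrite prime_idealrM negb_or => /andP[ap bp].
by split; [exists a | exists b].
Qed.

Lemma zariski_open_bigU (I : Type) (U : I -> set spec) :
  (forall i, zariski_open (U i)) -> zariski_open (\bigcup_i U i)%classic.
Proof.
move=> /choice[E UE].
exists (\bigcup_i E i)%classic; apply/seteqP; split=> p /=.
  by move=> [i _]; rewrite UE => -[a Ea ap]; exists a => //; exists i.
by move=> [a [i _ Ea] ap]; exists i => //; rewrite UE; exists a.
Qed.

HB.instance Definition _ := isOpenTopological.Build spec
  zariski_openT zariski_openI zariski_open_bigU.

End Spec.

Definition residue_ring (A : comNzRingType) (p : spec A) :=
  {ideal_quot p}.

HB.instance Definition _ (A : comNzRingType) (p : spec A) :=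
  GRing.ComNzRing.on (residue_ring p).

Definition residue_field (A : comNzRingType) (p : spec A) :=
  total_fractions (residue_ring p).

HB.instance Definition _ (A : comNzRingType) (p : spec A) :=
  GRing.ComNzRing.on (residue_field p).

Section SpecMap.
Variables (A B : comNzRingType) (f : {rmorphism A -> B}).

Definition preim_ideal (q : spec B) (a : A) : bool := f a \in spec_pred q.

Lemma preim_ideal_idealr q : idealr_closed (preim_ideal q).
Proof.
have [q0 q1 qD] := spec_idealr q; split; rewrite ?unfold_in /preim_ideal.
- by rewrite rmorph0.
- by rewrite rmorph1.
by move=> a u v; rewrite !unfold_in rmorphD rmorphM; exact: qD.
Qed.

Lemma preim_ideal_prime q : prime_idealr_closed (preim_ideal q).
Proof.
by move=> u v; rewrite !unfold_in /preim_ideal rmorphM; exact: spec_prime.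
Qed.

Definition spec_map (q : spec B) : spec A :=
  Spec (@preim_ideal_idealr q) (@preim_ideal_prime q).

Variable q : spec B.
Local Notation p := (spec_map q).

Definition residue_ring_map (x : residue_ring p) : residue_ring q :=
  \pi_(residue_ring q) (f (repr x)).

Lemma residue_ring_mapE a :
  residue_ring_map (\pi_(residue_ring p) a) = \pi_(residue_ring q) (f a).
Proof.
apply/eqP; rewrite /residue_ring_map -Quotient.idealrBE -rmorphB.
have : repr (\pi_(residue_ring p) a) == a %[mod residue_ring p] by rewrite reprK.
by rewrite -Quotient.idealrBE.
Qed.

Lemma residue_ring_map_zmod_morphism : zmod_morphism residue_ring_map.
Proof.
elim/quotW => x; elim/quotW => y.
by rewrite -rmorphB !residue_ring_mapE !rmorphB.
Qed.

Lemma residue_ring_map_monoid_morphism : monoid_morphism residue_ring_map.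
Proof.
split; first by rewrite -(rmorph1 \pi_(residue_ring p)) residue_ring_mapE !rmorph1.
elim/quotW => x; elim/quotW => y.
by rewrite -rmorphM !residue_ring_mapE !rmorphM.
Qed.

HB.instance Definition _ := GRing.isZmodMorphism.Build
  (residue_ring p) (residue_ring q)
  residue_ring_map residue_ring_map_zmod_morphism.
HB.instance Definition _ := GRing.isMonoidMorphism.Build
  (residue_ring p) (residue_ring q)
  residue_ring_map residue_ring_map_monoid_morphism.

Lemma residue_ring_map_eq0 x : residue_ring_map x = 0 -> x = 0.
Proof.
elim/quotW: x => x; rewrite residue_ring_mapE.
rewrite -(rmorph0 \pi_(residue_ring q)) -(rmorph0 \pi_(residue_ring p)).
move=> /eqP; rewrite -Quotient.idealrBE subr0 => fx.
by apply/eqP; rewrite -Quotient.idealrBE subr0.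
Qed.

Lemma residue_ring_map_lreg s :
  GRing.lreg s -> GRing.lreg (residue_ring_map s).
Proof.
move=> reg_s x y xy; apply/eqP; rewrite -subr_eq0.
have /Quotient.rquot_IdomainAxiom : residue_ring_map s * (x - y) = 0.
  by rewrite mulrBr xy subrr.
case/orP=> // /eqP/residue_ring_map_eq0 s0.
by move: (lreg_neq0 reg_s); rewrite s0 eqxx.
Qed.

Definition residue_field_map : residue_field p -> residue_field q :=
  total_fractions_map residue_ring_map_lreg.

HB.instance Definition _ := GRing.RMorphism.on residue_field_map.

End SpecMap.

(** * Normalisation *)

Section IntegralClosure.
Variables (A K : comNzRingType) (f : {rmorphism A -> K}).

Definition is_integral (x : K) : bool := `[<integralOver f x>].

Lemma is_integral_subring : subring_closed is_integral.
Proof.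
split=> [|x y /asboolP ix /asboolP iy|x y /asboolP ix /asboolP iy]; apply/asboolP.
- exact: integral1.
- exact: integral_sub.
- exact: integral_mul.
Qed.

HB.instance Definition _ :=
  GRing.isSubringClosed.Build K is_integral is_integral_subring.

Definition integral_closure := {x : K | is_integral x}.

HB.instance Definition _ := SubChoice.on integral_closure.
HB.instance Definition _ :=
  [SubChoice_isSubComNzRing of integral_closure by <:].

Lemma is_integral_base (a : A) : is_integral (f a).
Proof. by apply/asboolP; exact: integral_id. Qed.

Definition to_integral_closure (a : A) : integral_closure :=
  exist _ (f a) (is_integral_base a).

Lemma to_integral_closure_zmod_morphism : zmod_morphism to_integral_closure.
Proof. by move=> a b; apply: val_inj; rewrite /= !rmorphB. Qed.

Lemma to_integral_closure_monoid_morphism :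
  monoid_morphism to_integral_closure.
Proof.
by split=> [|a b]; apply: val_inj; rewrite /= ?rmorph1 ?rmorphM.
Qed.

HB.instance Definition _ := GRing.isZmodMorphism.Build A integral_closure
  to_integral_closure to_integral_closure_zmod_morphism.
HB.instance Definition _ := GRing.isMonoidMorphism.Build A integral_closure
  to_integral_closure to_integral_closure_monoid_morphism.

End IntegralClosure.

Section Normalisation.
Variable A : comNzRingType.

Definition nilpotent (a : A) : bool := `[<exists n, a ^+ n = 0>].

Lemma nilpotent_idealr_closed : idealr_closed nilpotent.
Proof.
split; rewrite ?unfold_in.
- by apply/asboolP; exists 1%N; rewrite expr1.
- by apply/asboolP => -[n /eqP]; rewrite expr1n oner_eq0.
move=> a u v /asboolP[m um] /asboolP[n vn]; apply/asboolP; exists (m + n)%N.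
rewrite exprDn big1 // => i _.
have [le_ni|lt_in] := leqP n i.
  by rewrite -(subnK le_ni) [v ^+ _]exprD vn mulr0 mulr0 mul0rn.
have le_mi : (m <= m + n - i)%N by rewrite -addnBA ?leq_addr // ltnW.
by rewrite exprMn -(subnK le_mi) [u ^+ _]exprD um !mulr0 mul0r mul0rn.
Qed.

HB.instance Definition _ := isIdealr.Build A nilpotent nilpotent_idealr_closed.

Definition nilradical : idealr A := Idealr.clone A nilpotent _.

Definition reduced_ring := {ideal_quot nilradical}.

HB.instance Definition _ := GRing.ComNzRing.on reduced_ring.

Definition normalisation :=
  integral_closure (@to_total_fractions reduced_ring).

HB.instance Definition _ := GRing.ComNzRing.on normalisation.

Definition to_normalisation : A -> normalisation :=
  to_integral_closure (@to_total_fractions reduced_ring) \o \pi_reduced_ring.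

HB.instance Definition _ := GRing.RMorphism.on to_normalisation.

End Normalisation.

(** * Tensor products and faithful flatness *)

Section Tensor.
Variables (R : comNzRingType) (M N : lmodType R).

(* A list stands for the formal sum of its pure tensors, with [::] as zero;
   opposites need no separate generator, since (- m, n) cancels (m, n). *)
Inductive tensor_rel : seq (M * N) -> seq (M * N) -> Prop :=
| tensor_refl s : tensor_rel s s
| tensor_sym s t : tensor_rel s t -> tensor_rel t s
| tensor_trans s t u : tensor_rel s t -> tensor_rel t u -> tensor_rel s u
| tensor_cat s s' t t' :
    tensor_rel s s' -> tensor_rel t t' -> tensor_rel (s ++ t) (s' ++ t')
| tensor_catC s t : tensor_rel (s ++ t) (t ++ s)
| tensor_addl m m' n : tensor_rel [:: (m + m', n)] [:: (m, n); (m', n)]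
| tensor_addr m n n' : tensor_rel [:: (m, n + n')] [:: (m, n); (m, n')]
| tensor_scale a m n : tensor_rel [:: (a *: m, n)] [:: (m, a *: n)]
| tensor_zero n : tensor_rel [:: (0, n)] [::].

Definition tensor_relb (s t : seq (M * N)) : bool := `[<tensor_rel s t>].

Lemma tensor_relb_refl : reflexive tensor_relb.
Proof. by move=> s; apply/asboolP; exact: tensor_refl. Qed.

Lemma tensor_relb_sym : symmetric tensor_relb.
Proof. by move=> s t; apply/asboolP/asboolP; exact: tensor_sym. Qed.

Lemma tensor_relb_trans : transitive tensor_relb.
Proof.
by move=> t s u /asboolP st /asboolP tu; apply/asboolP; exact: tensor_trans tu.
Qed.

Canonical tensor_equiv :=
  EquivRel tensor_relb tensor_relb_refl tensor_relb_sym tensor_relb_trans.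

Definition tensor := {eq_quot tensor_relb}.

HB.instance Definition _ : EqQuotient _ tensor_relb tensor :=
  EqQuotient.on tensor.
HB.instance Definition _ := Choice.on tensor.

Lemma tensor_relP s t : \pi_tensor s = \pi_tensor t <-> tensor_rel s t.
Proof. by split=> [/eqmodP/asboolP|h] //; apply/eqmodP/asboolP. Qed.

Lemma repr_tensor s : tensor_rel (repr (\pi_tensor s)) s.
Proof. by apply/tensor_relP; rewrite reprK. Qed.

Definition tensor_scale_seq (a : R) (s : seq (M * N)) : seq (M * N) :=
  [seq (a *: x.1, x.2) | x <- s].

Lemma tensor_scale_seq_rel a s t :
  tensor_rel s t -> tensor_rel (tensor_scale_seq a s) (tensor_scale_seq a t).
Proof.
elim=> {s t}.
- by move=> s; exact: tensor_refl.
- by move=> s t _; exact: tensor_sym.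
- by move=> s t u _ st _; exact: tensor_trans.
- move=> s s' t t' _ ss _ tt; rewrite /tensor_scale_seq !map_cat.
  exact: tensor_cat.
- by move=> s t; rewrite /tensor_scale_seq !map_cat; exact: tensor_catC.
- by move=> m m' n /=; rewrite scalerDr; exact: tensor_addl.
- by move=> m n n' /=; exact: tensor_addr.
- by move=> b m n /=; rewrite scalerA mulrC -scalerA; exact: tensor_scale.
- by move=> n /=; rewrite scaler0; exact: tensor_zero.
Qed.

Definition tensor_add (x y : tensor) : tensor := \pi_tensor (repr x ++ repr y).
Definition tensor_scaler (a : R) (x : tensor) : tensor :=
  \pi_tensor (tensor_scale_seq a (repr x)).
Definition tensor_opp : tensor -> tensor := tensor_scaler (-1).

Lemma tensor_addE s t :
  tensor_add (\pi_tensor s) (\pi_tensor t) = \pi_tensor (s ++ t).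
Proof. by apply/tensor_relP; apply: tensor_cat; exact: repr_tensor. Qed.

Lemma tensor_scalerE a s :
  tensor_scaler a (\pi_tensor s) = \pi_tensor (tensor_scale_seq a s).
Proof. by apply/tensor_relP/tensor_scale_seq_rel; exact: repr_tensor. Qed.

Lemma tensor_addA : associative tensor_add.
Proof.
elim/quotW=> s; elim/quotW=> t; elim/quotW=> u.
by rewrite (tensor_addE s t) (tensor_addE t u) !tensor_addE catA.
Qed.

Lemma tensor_addC : commutative tensor_add.
Proof.
elim/quotW=> s; elim/quotW=> t.
by rewrite !tensor_addE; apply/tensor_relP; exact: tensor_catC.
Qed.

Lemma tensor_add0 : left_id (\pi_tensor [::]) tensor_add.
Proof. by elim/quotW=> s; rewrite tensor_addE. Qed.

Lemma tensor_scaler_addl (x : tensor) :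
  {morph tensor_scaler^~ x : a b / a + b >-> tensor_add a b}.
Proof.
elim/quotW: x => s a b; rewrite !tensor_scalerE tensor_addE.
elim: s => [|[m n] s IH] //=; apply/tensor_relP.
move/tensor_relP in IH.
pose ss c := tensor_scale_seq c s.
apply: (tensor_trans (t := [:: (a *: m, n); (b *: m, n)] ++ (ss a ++ ss b))).
  rewrite -cat1s; apply: tensor_cat => //.
  by rewrite scalerDl; exact: tensor_addl.
apply: (@tensor_cat [:: _] [:: _] (_ :: _) (_ ++ _)).
  exact: tensor_refl.
rewrite -(cat1s (b *: m, n) (ss a ++ ss b)) -(cat1s (b *: m, n) (ss b)).
by rewrite !catA; apply: tensor_cat; [exact: tensor_catC | exact: tensor_refl].
Qed.

Lemma tensor_scaler1 : left_id 1 tensor_scaler.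
Proof.
elim/quotW=> s; rewrite tensor_scalerE; congr \pi_tensor.
by rewrite -[RHS]map_id; apply: eq_map => -[m n] /=; rewrite scale1r.
Qed.

Lemma tensor_scaler0 x : tensor_scaler 0 x = \pi_tensor [::].
Proof.
elim/quotW: x => s; rewrite tensor_scalerE; apply/tensor_relP.
elim: s => [|[m n] s IH] /=; first exact: tensor_refl.
rewrite -[X in tensor_rel X _]cat1s -[X in tensor_rel _ X]cat0s.
by apply: tensor_cat => //; rewrite scale0r; exact: tensor_zero.
Qed.

Lemma tensor_addN : left_inverse (\pi_tensor [::]) tensor_opp tensor_add.
Proof.
move=> x; rewrite /tensor_opp -{2}[x]tensor_scaler1 -tensor_scaler_addl.
by rewrite addNr tensor_scaler0.
Qed.

HB.instance Definition _ := GRing.isZmodule.Build tensor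
  tensor_addA tensor_addC tensor_add0 tensor_addN.

Lemma tensor_scalerA a b x :
  tensor_scaler a (tensor_scaler b x) = tensor_scaler (a * b) x.
Proof.
elim/quotW: x => s; rewrite (tensor_scalerE b s) !tensor_scalerE; congr \pi_tensor.
by rewrite /tensor_scale_seq -map_comp; apply: eq_map => -[m n] /=; rewrite scalerA.
Qed.

Lemma tensor_scaler_addr : right_distributive tensor_scaler +%R.
Proof.
move=> a; elim/quotW=> s; elim/quotW=> t.
rewrite -[_ + _]/(tensor_add _ _) -[RHS]/(tensor_add _ _).
by rewrite tensor_addE !tensor_scalerE tensor_addE -map_cat.
Qed.

HB.instance Definition _ := GRing.Zmodule_isLmodule.Build R tensor
  tensor_scalerA tensor_scaler1 tensor_scaler_addr tensor_scaler_addl.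

End Tensor.

Section TensorMap.
Variables (R : comNzRingType) (M M' N : lmodType R) (f : {linear M -> M'}).

Definition tensor_map_seq (s : seq (M * N)) : seq (M' * N) :=
  [seq (f x.1, x.2) | x <- s].

Lemma tensor_map_seq_rel s t :
  tensor_rel s t -> tensor_rel (tensor_map_seq s) (tensor_map_seq t).
Proof.
elim=> {s t}.
- by move=> s; exact: tensor_refl.
- by move=> s t _; exact: tensor_sym.
- by move=> s t u _ st _; exact: tensor_trans.
- move=> s s' t t' _ ss _ tt; rewrite /tensor_map_seq !map_cat.
  exact: tensor_cat.
- by move=> s t; rewrite /tensor_map_seq !map_cat; exact: tensor_catC.
- by move=> m m' n /=; rewrite linearD; exact: tensor_addl.
- by move=> m n n' /=; exact: tensor_addr.
- by move=> b m n /=; rewrite linearZ; exact: tensor_scale.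
- by move=> n /=; rewrite linear0; exact: tensor_zero.
Qed.

Definition tensor_map (x : tensor M N) : tensor M' N :=
  \pi_(tensor M' N) (tensor_map_seq (repr x)).

Lemma tensor_mapE s :
  tensor_map (\pi_(tensor M N) s) = \pi_(tensor M' N) (tensor_map_seq s).
Proof. by apply/tensor_relP/tensor_map_seq_rel; exact: repr_tensor. Qed.

Lemma tensor_map_linear : linear tensor_map.
Proof.
move=> a; elim/quotW=> s; elim/quotW=> t.
rewrite -[_ *: _ + _]/(tensor_add (tensor_scaler _ _) _).
rewrite -[RHS]/(tensor_add (tensor_scaler _ _) _).
rewrite tensor_scalerE tensor_addE !tensor_mapE tensor_scalerE tensor_addE.
rewrite /tensor_map_seq map_cat /tensor_scale_seq -!map_comp.
by congr (\pi_(tensor M' N) (_ ++ _)); apply: eq_map => -[m n] /=; rewrite linearZ.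
Qed.

HB.instance Definition _ := GRing.isLinear.Build R (tensor M N) (tensor M' N)
  _ tensor_map tensor_map_linear.

End TensorMap.

Definition exact_seq (R : comNzRingType) (M1 M2 M3 : lmodType R)
    (f : M1 -> M2) (g : M2 -> M3) : Prop :=
  forall y, g y = 0 <-> exists x, f x = y.

Definition faithfully_flat (R : comNzRingType) (M : lmodType R) : Prop :=
  forall (N1 N2 N3 : lmodType R) (f : {linear N1 -> N2}) (g : {linear N2 -> N3}),
    exact_seq f g <-> exact_seq (@tensor_map R N1 N2 M f) (@tensor_map R N2 N3 M g).

Definition finite_module (R : comNzRingType) (M : lmodType R) : Prop :=
  exists (n : nat) (e : 'I_n -> M),
    forall x, exists c : 'I_n -> R, x = \sum_i c i *: e i.

(** * Hensel valuation rings of finite rank *)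

Definition valuation_ring (R : idomainType) : Prop :=
  forall x : {fraction R},
    (exists a : R, x = tofrac a) \/ (exists a : R, x^-1 = tofrac a).

(* The ideals of type [idealr R] are proper. *)
Definition maximal_ideal (R : comNzRingType) (m : idealr R) : Prop :=
  forall J : idealr R, {subset m <= J} -> {subset J <= m}.

Definition local_ring (R : comNzRingType) : Prop :=
  exists2 m : idealr R, maximal_ideal m &
    forall m' : idealr R, maximal_ideal m' -> m' =i m.

Definition henselian (R : comNzRingType) : Prop :=
  local_ring R /\
  forall m : idealr R, maximal_ideal m ->
  forall (F : {poly R}) (a0 : {ideal_quot m}),
    let Fbar := map_poly \pi_{ideal_quot m} F in
    F \is monic -> root Fbar a0 -> ~~ root Fbar^`() a0 ->
    exists2 a : R, root F a & \pi_{ideal_quot m} a = a0.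

Definition finite_krull_dim (R : comNzRingType) : Prop :=
  exists d : nat, forall (n : nat) (p : 'I_n.+1 -> spec R),
    (forall i j : 'I_n.+1, (i < j)%N ->
       {subset spec_pred (p i) <= spec_pred (p j)} /\ p i <> p j) ->
    (n <= d)%N.

(** * Maps inducing isomorphisms on spectra and residue fields *)

Definition homeomorphism (X Y : topologicalType) (h : X -> Y) : Prop :=
  exists k : Y -> X, [/\ cancel h k, cancel k h, continuous h & continuous k].

(* In [residue_field_map f q] the source is the residue field of [spec_map f q]. *)
Definition spec_residue_iso (A B : comNzRingType) (f : {rmorphism A -> B}) :
    Prop :=
  homeomorphism (spec_map f) /\
  forall q : spec B, bijective (@residue_field_map A B f q).

(* Main.v *)
(* Choose a prime of A above the zero ideal of R, let L be the fraction field of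
   the quotient and O the integral closure of R in L.  The algebra A' is
   generated, inside L, by the image of A and finitely many elements of O; it is
   finite and torsion-free over a valuation ring, hence free.

   The normalisation N of any domain A' that is finite over R is a valuation
   ring: R being henselian, N is local, and then a root of a polynomial with a
   unit coefficient lies in N together with its inverse or else has its inverse
   in N.  Thus each prime of R has exactly one prime of N above it, so
   Spec N -> Spec A' is bijective, and it is then a homeomorphism.

   For locality let x be integral over R with minimal polynomial P, and suppose
   that P mod m has exactly r nonzero roots, 0 < r.  The polynomial H whose roots
   are the products of r roots of P has a simple nonzero root mod m, so H has a
   root b in R, a unit; b is a product of r conjugates of x, hence those
   conjugates, and therefore x, are invertible over R.  If r = 0, then 1 - x is
   invertible.

   For the residue fields, a family in O that is independent over R/p modulo a
   prime of O above p is linearly independent over R (divide a relation by its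
   largest coefficient), so it has at most [L : Frac R] members.  It suffices to
   put into A' a maximal such family for each of the finitely many primes p. *)

Require Import Defs.
From HB Require Import structures.
From mathcomp Require Import all_boot all_order all_algebra ring.
From mathcomp Require Import boolp classical_sets.
From mathcomp Require Import topology_structure.

Set Implicit Arguments.
Unset Strict Implicit.
Unset Printing Implicit Defensive.

Import GRing.Theory.

Local Open Scope ring_scope.
Local Open Scope quotient_scope.

(** * Prime ideals and fraction fields *)

Lemma inj_surj_bijective (T U : Type) (f : T -> U) :
  injective f -> (forall y, exists x, f x = y) -> bijective f.
Proof.
move=> f_inj /choice[g fg]; exists g => // x; exact/f_inj/fg.
Qed.

(** Zorn's lemma gives an ideal maximal among those containing [I] and disjoint from the
    multiplicative set [S], and maximality makes it prime. The last conclusion keeps this maximality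
    for lying over. *)
Lemma prime_avoiding (B : comNzRingType) (S I : B -> Prop) :
  S 1 -> (forall x y, S x -> S y -> S (x * y)) ->
  I 0 -> (forall a u v, I u -> I v -> I (a * u + v)) ->
  (forall x, I x -> ~ S x) ->
  exists q : spec B, [/\ forall x, I x -> x \in spec_pred q,
    forall x, x \in spec_pred q -> ~ S x
    & forall b, b \notin spec_pred q ->
      exists y c, y \in spec_pred q /\ S (y + c * b)].
Proof.
move=> S1 SM I0 Ilin IS.
pose lin (J : set B) := forall a u v, J u -> J v -> J (a * u + v).
(* The conditions bind only nonempty sets, so that the union of the empty chain is admissible. *)
pose P := [set J : set B | (exists x, J x) ->
  [/\ (I `<=` J)%classic, lin J & forall x, J x -> ~ S x]]%classic.
have [F FP totF|J [PJ Jmax]] := @Zorn_bigcup B P.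
  move=> [x [J FJ Jx]]; have JP K u : F K -> K u -> _ := fun FK Ku => FP K FK (ex_intro _ u Ku).
  have [IJ _ _] := JP J x FJ Jx; split=> [y Iy|a u v [K FK Ku] [K' FK' Kv]|y [K FK Ky]].
  - by exists J => //; exact: IJ.
  - have [sub|sub] := totF K K' FK FK'.
      have [_ lK _] := JP _ _ FK' Kv.
      by exists K' => //; apply: lK => //; exact: sub.
    have [_ lK _] := JP _ _ FK Ku.
    by exists K => //; apply: lK => //; exact: sub.
  - by have [_ _] := JP _ _ FK Ky; apply.
have J0 : exists x, J x.
  apply: contrapT => nJ; apply: (Jmax I) => [|_]; last by split.
  split=> [x Jx|IJ]; first by case: nJ; exists x.
  by apply: nJ; exists 0; exact: IJ.
have [IJ linJ JS] := PJ J0.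
have {}J0 := IJ _ I0.
have JD u v : J u -> J v -> J (u + v) by move=> Ju; rewrite -[u]mul1r; exact: linJ.
have JM a u : J u -> J (a * u) by move=> Ju; rewrite -[_ * _]addr0; exact: linJ.
have Jext b : ~ J b -> exists y c, J y /\ S (y + c * b).
  move=> Jb; apply: contrapT => nS.
  pose J' := [set x | exists y c, J y /\ x = y + c * b]%classic.
  apply: (Jmax J') => [|_].
    split=> [x Jx|JJ]; first by exists x, 0; rewrite mul0r addr0.
    by apply/Jb/JJ; exists 0, 1; rewrite mul1r add0r.
  split.
  - by move=> x Ix; exists x, 0; rewrite mul0r addr0; split=> //; exact: IJ.
  - move=> a _ _ [y [c [Jy ->]]] [y' [c' [Jy' ->]]].
    by exists (a * y + y'), (a * c + c'); split; [exact: linJ | ring].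
  - by move=> _ [y [c [Jy ->]]] Sx; apply: nS; exists y, c.
pose j x := `[<J x>].
have jP x : (x \in j) = `[<J x>] by [].
have j_ideal : idealr_closed j.
  split; rewrite ?jP; [exact/asboolP|apply/asboolP => /JS; exact |].
  by move=> a u v /asboolP Ju /asboolP Jv; apply/asboolP; exact: linJ.
have j_prime : prime_idealr_closed j.
  move=> u v /asboolP Juv; apply/orP.
  have [Ju|nJu] := pselect (J u); first by left; exact/asboolP.
  have [Jv|nJv] := pselect (J v); first by right; exact/asboolP.
  have [y [c [Jy Su]]] := Jext u nJu; have [z [d [Jz Sv]]] := Jext v nJv.
  case: (JS _ _ (SM _ _ Su Sv)).
  rewrite (_ : _ * _ = z * y + (d * v * y + (c * u * z + c * d * (u * v))));
    last by ring.
  by apply: (JD _ _ (JM _ _ Jy)); apply: (JD _ _ (JM _ _ Jy));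
    apply: (JD _ _ (JM _ _ Jz)); apply: JM.
exists (Spec j_ideal j_prime); split=> [x /IJ Jx|x /asboolP /JS //|b /asboolP /Jext].
  exact/asboolP.
by move=> [y [c [Jy Sy]]]; exists y, c; split=> //; exact/asboolP.
Qed.

Definition domain_axiom (B : comNzRingType) :=
  forall x y : B, x * y = 0 -> x = 0 \/ y = 0.

Lemma domain_lreg (B : comNzRingType) (s : B) :
  domain_axiom B -> s != 0 -> GRing.lreg s.
Proof.
move=> domB s0 x y /eqP; rewrite -subr_eq0 -mulrBr => /eqP/domB[/eqP|/eqP].
  by rewrite (negPf s0).
by rewrite subr_eq0 => /eqP.
Qed.

Lemma total_fractions_field (B : comNzRingType) : domain_axiom B ->
  exists (F : fieldType) (h : {rmorphism total_fractions B -> F}), bijective h.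
Proof.
move=> domB.
have inv_ex (x : total_fractions B) : exists y, (x != 0 -> y * x = 1) /\ (x = 0 -> y = 0).
  have [->|x0] := eqVneq x 0; first by exists 0; split=> // /eqP.
  have [a [s [reg_s xE]]] := tfrac_ex x.
  have a0 : a != 0.
    apply: contra_neq x0 => a0; rewrite xE a0.
    by apply/tfrac_eqP; rewrite !mul0r.
  exists (tfrac s (domain_lreg domB a0)); split=> [_|/eqP]; last by rewrite (negPf x0).
  by rewrite xE -[LHS]/(tmul _ _) tmulE; apply/tfrac_eqP; rewrite mulr1 mul1r mulrC.
have [inv invP] := choice inv_ex.
have mulVf x : x != 0 -> inv x * x = 1 by case: (invP x).
have inv0 : inv 0 = 0 by case: (invP 0) => _; apply.
pose mx := GRing.ComNzRing_isField.Build (total_fractions B) mulVf inv0.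
pose F : fieldType := HB.pack (total_fractions B) mx.
pose h : total_fractions B -> F := id.
have hz : zmod_morphism h by [].
have hm : monoid_morphism h by [].
pose h' : {rmorphism total_fractions B -> F} := HB.pack h
  (GRing.isZmodMorphism.Build _ _ h hz) (GRing.isMonoidMorphism.Build _ _ h hm).
by exists F, h', h.
Qed.

Lemma fraction_field (B : comNzRingType) : domain_axiom B ->
  exists (F : fieldType) (h : {rmorphism B -> F}), injective h /\
    forall z, exists a s, h s != 0 /\ z = h a / h s.
Proof.
move=> domB; have [F [h bij_h]] := total_fractions_field domB.
have h_inj := bij_inj bij_h; have [k _ hK] := bij_h.
pose hB : {rmorphism B -> F} := h \o @to_total_fractions B.
have hB_inj : injective hB.
  by move=> x y /h_inj/tfrac_eqP; rewrite !mulr1.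
exists F, hB; split=> // z.
have [a [s [reg_s kz]]] := tfrac_ex (k z).
have s0 : hB s != 0 by rewrite -(rmorph0 hB) (inj_eq hB_inj) lreg_neq0.
exists a, s; split=> //; apply: (mulIf s0); rewrite divfK // -[z]hK -rmorphM.
congr (h _); rewrite kz -[LHS]/(tmul _ _) tmulE.
by apply/tfrac_eqP; ring.
Qed.

Lemma pi_eq0 (B : comNzRingType) (I : idealr B) (x : B) :
  (\pi_{ideal_quot I} x == 0) = (x \in I).
Proof. by rewrite -(rmorph0 \pi_{ideal_quot I}) -Quotient.idealrBE subr0. Qed.

Lemma ideal_quot_domain (B : comNzRingType) (q : prime_idealr B) :
  domain_axiom {ideal_quot q}.
Proof.
by move=> x y /Quotient.rquot_IdomainAxiom/orP[]/eqP; [left|right].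
Qed.

(** A model of the residue field at [q] as a [fieldType], known only through its kernel and its
    fractions. *)
Lemma residue_field_ex (B : comNzRingType) (q : spec B) :
  exists (F : fieldType) (h : {rmorphism B -> F}),
    (forall b, (h b == 0) = (b \in spec_pred q)) /\
    forall z, exists a s, h s != 0 /\ z = h a / h s.
Proof.
have [F [h [h_inj hfrac]]] := fraction_field (@ideal_quot_domain B q).
exists F, (h \o \pi_{ideal_quot q}); split=> [b|z].
  by rewrite /= -(rmorph0 h) (inj_eq h_inj) pi_eq0.
have [a [s]] := hfrac z.
by elim/quotW: a; elim/quotW: s => a s ?; exists s, a.
Qed.

Lemma fraction_lift (B : comNzRingType) (F L : fieldType)
    (j : {rmorphism B -> F}) (psi : {rmorphism B -> L}) :
  injective j -> injective psi ->
  (forall z, exists a s, j s != 0 /\ z = j a / j s) ->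
  exists h : {rmorphism F -> L}, forall b, h (j b) = psi b.
Proof.
move=> j_inj psi_inj jfrac.
have nz s : (psi s == 0) = (j s == 0).
  by rewrite -(rmorph0 psi) -(rmorph0 j) !inj_eq.
(* The value is required for every presentation of [z], so [h0] is independent of presentations as
   soon as it is chosen. *)
have h_ex z : exists y, forall a s, j s != 0 -> z = j a / j s -> y = psi a / psi s.
  have [a [s [s0 ->]]] := jfrac z; exists (psi a / psi s) => b t t0 /eqP.
  rewrite eqr_div // -!rmorphM => /eqP/j_inj e.
  by apply/eqP; rewrite eqr_div ?nz // -!rmorphM e.
have [h0 h0P] := choice h_ex.
have h0B : zmod_morphism h0.
  move=> x y; have [a [s [s0 xE]]] := jfrac x; have [b [t [t0 yE]]] := jfrac y.
  rewrite (h0P _ _ _ s0 xE) (h0P _ _ _ t0 yE).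
  rewrite (h0P _ (a * t - b * s) (s * t)) ?rmorphM ?rmorphB ?mulf_neq0 //.
    by rewrite !rmorphM; field; rewrite !nz s0 t0.
  by rewrite xE yE !rmorphM; field; rewrite s0 t0.
have h0M : monoid_morphism h0.
  split=> [|x y].
    by rewrite (h0P _ 1 1) ?rmorph1 ?divr1 // oner_neq0.
  have [a [s [s0 xE]]] := jfrac x; have [b [t [t0 yE]]] := jfrac y.
  rewrite (h0P _ _ _ s0 xE) (h0P _ _ _ t0 yE).
  rewrite (h0P _ (a * b) (s * t)) ?rmorphM ?mulf_neq0 //.
    by field; rewrite !nz s0 t0.
  by rewrite xE yE; field; rewrite s0 t0.
pose h : {rmorphism F -> L} := HB.pack h0
  (GRing.isZmodMorphism.Build _ _ h0 h0B) (GRing.isMonoidMorphism.Build _ _ h0 h0M).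
exists h => b; rewrite [LHS](h0P _ b 1) ?rmorph1 ?divr1 //.
exact: oner_neq0.
Qed.

(** * Splitting polynomials and symmetric functions *)

Lemma splitting_extension (F : fieldType) (p : {poly F}) : p \is monic ->
  exists (E : fieldType) (phi : {rmorphism F -> E}) (s : seq E),
    map_poly phi p = \prod_(a <- s) ('X - a%:P).
Proof.
have [n le_pn] := ubnP (size p); elim: n => // n IHn in F p le_pn *.
move=> mon_p; have [p1|sz_p] := leqP (size p) 1.
  exists F, idfun, [::]; rewrite big_nil map_poly_id //.
  have p_neq0 := monic_neq0 mon_p.
  have/eqP := mon_p; rewrite (size1_polyC p1) lead_coefC => ->.
  by rewrite polyC1.
(* With 1 as the only element to avoid, this is a prime of [{poly F}] containing [p]; the image of
   ['X] in its residue field is a root of [p]. *)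
have [||||x|q [Iq _ _]] := @prime_avoiding {poly F} (fun x => x = 1) (fun x => p %| x).
- by [].
- by move=> x y -> ->; rewrite mulr1.
- exact: dvdp0.
- by move=> a u v pu pv; rewrite dvdp_add // dvdp_mull.
- by move=> px x1; move: px; rewrite x1 dvdp1 => /eqP sz1; rewrite sz1 in sz_p.
have [E1 [h [hq _]]] := residue_field_ex q.
pose phi1 : {rmorphism F -> E1} := h \o polyC.
have /factor_theorem[r pE] : root (map_poly phi1 p) (h 'X).
  rewrite /root map_poly_comp horner_map /=.
  have -> : (map_poly polyC p).['X] = p.
    by rewrite -[RHS]comp_polyXr.
  by rewrite hq Iq.
have mon_r : r \is monic.
  by rewrite -(monicMr _ (monicXsubC (h 'X))) -pE map_monic.
have sz_r : (size r < n)%N.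
  have := congr1 (fun p : {poly _} => size p) pE.
  rewrite size_map_poly size_Mmonic ?monic_neq0 ?monicXsubC // size_XsubC addn2 /= => e.
  by rewrite -ltnS -e.
have [E [phi [s rE]]] := IHn _ r sz_r mon_r.
exists E, (phi \o phi1), (phi (h 'X) :: s).
rewrite map_poly_comp pE rmorphM /= rE big_cons mulrC.
by rewrite rmorphB /= map_polyX map_polyC.
Qed.

Module SymmetricFunctions.
From mathcomp Require Import fingroup perm mpoly.

Lemma elementary_eval (R : comNzRingType) (n : nat) (P : {poly R}) (F : fieldType)
    (phi : {rmorphism R -> F}) (alpha : 'I_n -> F) (i : 'I_n) :
  map_poly phi P = \prod_i ('X - (alpha i)%:P) ->
  phi ((-1) ^+ i.+1 * P`_(n - i.+1)) = meval alpha (mesym n F i.+1).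
Proof.
move=> PE; have lt_i : (i.+1 < n.+1)%N by rewrite ltnS ltn_ord.
have := @mroots_coeff F n (map_tuple alpha (ord_tuple n)) (Ordinal lt_i).
rewrite big_map big_enum /= -PE coef_map /= => e.
rewrite rmorphM rmorphXn rmorphN1 e mulrA -exprMn mulrNN mulr1 expr1n mul1r.
by apply: meval_eq => j; rewrite tnth_map tnth_ord_tuple.
Qed.

(** The product over the r-subsets of the indeterminates has symmetric coefficients, hence
    polynomials in the elementary symmetric functions; substituting the signed coefficients of [P]
    gives [H]. One [H] serves every field in which [P] splits, so roots in characteristic-free and
    residual settings can be compared. *)
Lemma subset_products (R : comNzRingType) (n r : nat) (P : {poly R}) :
  exists H : {poly R}, forall (F : fieldType) (phi : {rmorphism R -> F})
    (alpha : 'I_n -> F),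
  map_poly phi P = \prod_i ('X - (alpha i)%:P) ->
  map_poly phi H =
    \prod_(I : {set 'I_n} | #|I| == r) ('X - (\prod_(i in I) alpha i)%:P).
Proof.
pose u (I : {set 'I_n}) : {mpoly R[n]} := (\prod_(i in I) 'X_i)%R.
pose U : {poly {mpoly R[n]}} := \prod_(I : {set 'I_n} | #|I| == r) ('X - (u I)%:P).
have Usym k : U`_k \is symmetric.
  apply/issymP => s; rewrite -coef_map; congr (polyseq _)`_k.
  rewrite rmorph_prod [RHS](reindex_inj (imset_inj (@perm_inj _ s))) /=.
  apply: eq_big => [I|I _]; first by rewrite card_imset //; exact: perm_inj.
  rewrite rmorphB /= map_polyX map_polyC /=; congr (_ - _%:P).
  rewrite rmorph_prod /u big_imset /=; last by move=> ? ? _ _; exact: perm_inj.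
  by apply: eq_bigr => i _; rewrite /msym mmapX mmap1U.
have tP k := sym_fundamental (Usym k).
pose t k := sval (tP k).
have tE k : U`_k = t k \mPo [tuple mesym n R i.+1 | i < n].
  by rewrite /t; case: (tP k) => ? [].
pose v (i : 'I_n) := (-1) ^+ i.+1 * P`_(n - i.+1).
exists (\poly_(k < size U) meval v (t k)) => F phi alpha PE.
pose ev : {rmorphism {mpoly R[n]} -> F} := meval alpha \o map_mpoly phi.
have evX i : ev 'X_i = alpha i by rewrite /= map_mpolyX mevalXU.
transitivity (map_poly ev U).
  apply/polyP => k; rewrite !coef_map coef_poly.
  case: ltnP => [_|szU]; last first.
    rewrite (nth_default _ szU).
    exact: etrans (rmorph0 phi) (esym (rmorph0 ev)).
  rewrite tE comp_mpolyE mevalE (raddf_sum phi) (raddf_sum ev); apply: eq_bigr => m _.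
  rewrite /= map_mpolyZ mevalZ rmorphM; congr (_ * _).
  rewrite !rmorph_prod; apply: eq_bigr => i _; rewrite !rmorphXn /=; congr (_ ^+ _).
  rewrite (elementary_eval i PE) tnth_map tnth_ord_tuple; congr meval.
  rewrite /mesym rmorph_sum; apply: eq_bigr => I _; rewrite rmorph_prod.
  by apply: eq_bigr => j _; rewrite /= map_mpolyX.
rewrite rmorph_prod; apply: eq_bigr => I _.
rewrite rmorphB /= map_polyX map_polyC /=; congr (_ - _%:P).
by rewrite -[LHS]/(ev _) rmorph_prod; apply: eq_bigr => i _; exact: evX.
Qed.

End SymmetricFunctions.

(** * Integral elements and valuation rings *)

Lemma horner_sub_dvd (B : comNzRingType) (p : {poly B}) (a b : B) :
  exists c, p.[a] - p.[b] = (a - b) * c.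
Proof.
have /factor_theorem[q pE] : root (p - p.[b]%:P) b.
  by rewrite /root hornerD hornerN hornerC subrr.
have /(congr1 (horner^~ a)) := pE.
by rewrite hornerD hornerN hornerC hornerM hornerXsubC mulrC => ->; exists q.[a].
Qed.

Section IntegralUnits.
Variables (B C : comNzRingType) (phi : {rmorphism B -> C}).

Lemma integral_horner_map (p : {poly B}) x :
  integralOver phi x -> integralOver phi (map_poly phi p).[x].
Proof.
move=> int_x; apply: integral_horner => //.
by apply/integral_poly => i; rewrite coef_map; exact: integral_id.
Qed.

Lemma integral_prod (I : Type) (s : seq I) (P : pred I) (F : I -> C) :
  (forall i, P i -> integralOver phi (F i)) ->
  integralOver phi (\prod_(i <- s | P i) F i).
Proof.
move=> intF; elim/big_ind: _ => //; first exact: integral1.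
exact: integral_mul.
Qed.

(** Reverse a monic equation of [y]: multiplying it by [x ^+ n] turns powers of [y] into powers of
    [x], and the leading 1 becomes the constant term. *)
Lemma integral_inverse_root x y : x * y = 1 -> integralOver phi y ->
  exists q : {poly B}, q.[0] = 1 /\ (map_poly phi q).[x] = 0.
Proof.
move=> xy1 [p mon_p /rootP py0].
have sz_p : size p = (size p).-1.+1 by rewrite prednK // size_poly_gt0 monic_neq0.
set n := (size p).-1 in sz_p.
exists (\sum_(i < n.+1) p`_i *: 'X^(n - i)); split.
  rewrite horner_sum big_ord_recr /= subnn hornerZ hornerXn expr0 mulr1.
  rewrite big1 ?add0r => [|i _]; first exact/eqP.
  by rewrite hornerZ hornerXn expr0n subn_eq0 leqNgt ltn_ord mulr0.
have : x ^+ n * (map_poly phi p).[y] = 0 by rewrite py0 mulr0.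
rewrite (@horner_coef_wide _ n.+1) ?size_map_poly ?sz_p //; last first.
  by rewrite -sz_p; exact: size_poly.
move=> e; rewrite -[RHS]e mulr_sumr rmorph_sum horner_sum; apply: eq_bigr => i _.
rewrite /= map_polyZ map_polyXn hornerZ hornerXn coef_map mulrCA; congr (_ * _).
have le_in : (i <= n)%N by rewrite -ltnS.
by rewrite -[X in x ^+ X * _](subnK le_in) exprD -mulrA -exprMn xy1 expr1n mulr1.
Qed.

(** Dividing [q - q.[a]%:P] by ['X - a%:P] and evaluating at [x] writes the unit [phi q.[a]] as
    [phi a - x] times an integral element. *)
Lemma integral_unit_of_root x (q : {poly B}) (a : B) : integralOver phi x ->
  (exists b, q.[a] * b = 1) -> (map_poly phi q).[x] = 0 ->
  exists y, integralOver phi y /\ (phi a - x) * y = 1.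
Proof.
move=> int_x [b qab] qx0.
have /factor_theorem[d qE] : root (q - q.[a]%:P) a.
  by rewrite /root hornerD hornerN hornerC subrr.
exists ((map_poly phi d).[x] * phi b); split.
  by apply: integral_mul; [exact: integral_horner_map | exact: integral_id].
have /(congr1 (fun p => (map_poly phi p).[x])) := qE.
rewrite rmorphB rmorphM /= rmorphB /= map_polyX !map_polyC /=.
rewrite hornerD hornerN hornerC hornerM hornerXsubC qx0 sub0r => e.
rewrite -(rmorph1 phi) -qab rmorphM -[phi q.[a]]opprK e; ring.
Qed.

End IntegralUnits.

Section ValuationRing.
Variable R : idomainType.
Hypothesis valR : valuation_ring R.
Local Notation K := {fraction R}.
Local Notation tofrac := (@FracField.tofrac R).

Lemma tofrac_inj : injective tofrac.
Proof. by move=> a b /eqP; rewrite tofrac_eq => /eqP. Qed.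

Lemma valuation_fraction (z : K) :
  exists a s, tofrac s != 0 /\ z = tofrac a / tofrac s.
Proof.
have [[a ->]|[a za]] := valR z.
  by exists a, 1; rewrite rmorph1 divr1 oner_neq0.
have [a0|a_neq0] := eqVneq (tofrac a) 0; last first.
  by exists 1, a; split; rewrite ?rmorph1 // -za mul1r invrK.
exists 0, 1; rewrite rmorph1 divr1 oner_neq0 rmorph0.
by split=> //; apply/eqP; rewrite -invr_eq0 za a0.
Qed.

Lemma valuation_dvd (a b : R) : (exists c, b = a * c) \/ (exists c, a = b * c).
Proof.
have [->|b0] := eqVneq b 0; first by left; exists 0; rewrite mulr0.
have [->|a0] := eqVneq a 0; first by right; exists 0; rewrite mulr0.
have [[c e]|[c e]] := valR (tofrac a / tofrac b).
  right; exists c; apply: tofrac_inj; rewrite tofracM -e mulrC divfK //.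
  by rewrite tofrac_eq0.
left; exists c; apply: tofrac_inj; rewrite tofracM -e invf_div mulrC divfK //.
by rewrite tofrac_eq0.
Qed.

(** If the inverse [a] of [z] lies in R instead, the reversed equation of [z] vanishes at [a] and
    has constant term 1, so [a] divides 1. *)
Lemma valuation_normal (z : K) : integralOver tofrac z -> exists a, z = tofrac a.
Proof.
move=> int_z; have [//|[a za]] := valR z.
have [z0|z_neq0] := eqVneq z 0; first by exists 0; rewrite rmorph0.
have az1 : tofrac a * z = 1 by rewrite -za mulVf.
have [q [q0 qa]] := integral_inverse_root az1 int_z.
have {}qa : q.[a] = 0 by apply: tofrac_inj; rewrite rmorph0 -qa horner_map.
have [c] := horner_sub_dvd q a 0; rewrite qa q0 subr0 sub0r => ac.
exists (- c); apply: (mulfI (x := tofrac a)).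
  by apply: contra_eq_neq az1 => ->; rewrite mul0r eq_sym oner_neq0.
by rewrite az1 -rmorphM mulrN -ac opprK rmorph1.
Qed.

(** Divisibility in R is total, so some member of a finite family divides all the others. Dividing a
    linear relation by this largest coefficient leaves a coefficient equal to 1. *)
Lemma valuation_min (n : nat) (c : 'I_n -> R) : (exists i, c i != 0) ->
  exists i (d : 'I_n -> R), c i != 0 /\ forall j, c j = c i * d j.
Proof.
move=> [i0 ci0].
suff [i [ci P]] : exists i, c i != 0 /\ forall j, exists d, c j = c i * d.
  by have [d dP] := choice P; exists i, d.
have : forall s : seq 'I_n, exists i, c i != 0 /\
    forall j, j \in s -> exists d, c j = c i * d.
  elim=> [|k s [i [ci P]]]; first by exists i0.
  have [[d e]|[d e]] := valuation_dvd (c i) (c k).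
    exists i; split=> // j; rewrite inE => /orP[/eqP->|/P //]; by exists d.
  exists k; split=> [|j]; first by apply: contra_neq ci; rewrite e => ->; rewrite mul0r.
  rewrite inE => /orP[/eqP->|/P[d' ->]]; first by exists 1; rewrite mulr1.
  by exists (d * d'); rewrite e mulrA.
by move=> /(_ (enum 'I_n))[i [ci P]]; exists i; split=> // j; apply: P; rewrite mem_enum.
Qed.

(** The multiples of a non-unit form a proper ideal. As divisibility is total and [a] is outside
    [m], this ideal contains [m], and maximality would put [a] into [m]. *)
Lemma maximal_unit (m : idealr R) (a : R) : maximal_ideal m -> a \notin m ->
  exists b, a * b = 1.
Proof.
move=> max_m am; apply: contrapT => nu.
pose J x := `[<exists c, x = a * c>].
have J_ideal : idealr_closed J.
  split; rewrite ?unfold_in.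
  - by apply/asboolP; exists 0; rewrite mulr0.
  - by apply/asboolP => -[c e]; apply: nu; exists c.
  move=> r u v /asboolP[c ->] /asboolP[d ->]; apply/asboolP.
  by exists (r * c + d); ring.
pose mJ := isIdealr.Build R J J_ideal.
pose J' : idealr R := HB.pack J mJ.
have mJ' : {subset m <= J'}.
  move=> y my; apply/asboolP.
  have [//|[c e]] := valuation_dvd a y.
  by case/negP: am; rewrite e mulrC idealMr.
case/negP: am; apply: (max_m J' mJ').
by apply/asboolP; exists 1; rewrite mulr1.
Qed.

Lemma hensel_root : henselian R -> exists m : spec R,
  (forall a, a \notin spec_pred m -> exists b, a * b = 1) /\
  forall (F : {poly R}) c, F \is monic -> F.[c] \in spec_pred m ->
    F^`().[c] \notin spec_pred m ->
    exists b, F.[b] = 0 /\ b - c \in spec_pred m.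
Proof.
move=> [[m max_m _] /(_ m max_m) henR].
have unitP := maximal_unit max_m.
pose S x := x \in m; have SE x : (x \in S) = (x \in m) by [].
have m_ideal : idealr_closed S.
  split; rewrite ?SE ?rpred0 ?idealr1 // => a u v; rewrite !SE => mu mv.
  by rewrite rpredD // idealMr.
have m_prime : prime_idealr_closed S.
  move=> u v; rewrite !SE => muv; case: (boolP (u \in m)) => //= um.
  have [b ub] := unitP u um.
  by rewrite -[v]mul1r -ub mulrAC mulrC idealMr.
exists (Spec m_ideal m_prime); split=> [a|F c]; first exact: unitP.
rewrite /= !SE.
move=> mon_F Fc F'c; pose pi : {rmorphism R -> {ideal_quot m}} := \pi_{ideal_quot m}.
have [|||b /rootP Fb /eqP bc] := henR F (pi c); rewrite ?mon_F //.
- by rewrite /root (horner_map pi) pi_eq0.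
- by rewrite deriv_map /root (horner_map pi) pi_eq0.
exists b; split=> //.
by rewrite -pi_eq0 (rmorphB pi) /= subr_eq0.
Qed.

End ValuationRing.

(** * Integral extensions of henselian valuation rings *)

Lemma minimal_polynomial (K F : fieldType) (kappa : {rmorphism K -> F}) (x : F) :
  algebraicOver kappa x ->
  exists p : {poly K}, [/\ p \is monic, (map_poly kappa p).[x] = 0 &
    forall q : {poly K}, (map_poly kappa q).[x] = 0 -> (size q < size p)%N -> q = 0].
Proof.
move=> [p0 p0_neq0 /rootP p0x].
pose P n := `[<exists p : {poly K}, [/\ p != 0, (map_poly kappa p).[x] = 0 & size p = n]>].
have exP : exists n, P n by exists (size p0); apply/asboolP; exists p0.
case: (ex_minnP exP) => n /asboolP[p [p_neq0 px sz_p]] n_min.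
have lc_neq0 : (lead_coef p)^-1 != 0 by rewrite invr_eq0 lead_coef_eq0.
exists ((lead_coef p)^-1 *: p); split=> [||q qx].
- by rewrite monicE lead_coefZ mulVf // lead_coef_eq0.
- by rewrite map_polyZ hornerZ px mulr0.
rewrite size_scale // sz_p ltnNge => /negP nlt; apply: contrapT => /eqP q_neq0.
by apply/nlt/n_min/asboolP; exists q.
Qed.

(** The gcd of [p] and [q] vanishes at [a], so its cofactor in [p] has smaller degree than [p] and
    cannot vanish at [x]; hence the gcd does. Relations thus pass from a conjugate to [x]. *)
Lemma minimal_polynomial_conj (K F E : fieldType) (kappa : {rmorphism K -> F})
    (chi : {rmorphism K -> E}) (x : F) (p : {poly K}) (a : E) (q : {poly K}) :
  p \is monic -> (map_poly kappa p).[x] = 0 ->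
  (forall q : {poly K}, (map_poly kappa q).[x] = 0 -> (size q < size p)%N -> q = 0) ->
  root (map_poly chi p) a -> root (map_poly chi q) a -> (map_poly kappa q).[x] = 0.
Proof.
move=> mon_p px p_min pa qa; have p_neq0 := monic_neq0 mon_p.
set g := gcdp p q.
have ga : root (map_poly chi g) a by rewrite gcdp_map root_gcd pa.
have g_neq0 : g != 0 by rewrite gcdp_eq0 negb_and p_neq0.
have /dvdpP[h pE] : g %| p := dvdp_gcdl p q.
have h_neq0 : h != 0 by apply: contra_neq p_neq0; rewrite pE => ->; rewrite mul0r.
have lt_hp : (size h < size p)%N.
  rewrite pE size_mul // -subn1 -addnBA ?size_poly_gt0 // subn1 -[X in (X < _)%N]addn0.
  rewrite ltn_add2l -ltnS prednK ?size_poly_gt0 // -(size_map_poly chi).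
  by apply: root_size_gt1 ga; rewrite map_poly_eq0.
have gx : (map_poly kappa g).[x] = 0.
  have /eqP : (map_poly kappa h).[x] * (map_poly kappa g).[x] = 0.
    by rewrite -hornerM -rmorphM -pE.
  rewrite mulf_eq0 => /orP[/eqP hx|/eqP //].
  by rewrite (p_min h) ?eqxx in h_neq0.
have /dvdpP[d ->] : g %| q := dvdp_gcdr p q.
by rewrite rmorphM hornerM gx mulr0.
Qed.

Section HenselValuation.
Variable R : idomainType.
Hypotheses (valR : valuation_ring R) (henR : henselian R).
Local Notation K := {fraction R}.
Local Notation tofrac := (@FracField.tofrac R).
Variables (F : fieldType) (phi : {rmorphism R -> F}).
Hypothesis phi_inj : injective phi.

(** The minimal polynomial over the fraction field divides a monic equation over R, so its roots are
    integral; then so are its coefficients, and R is integrally closed. *)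
Lemma integral_minimal_polynomial (x : F) : integralOver phi x ->
  exists (p : {poly R}) (E : fieldType) (psi : {rmorphism R -> E}) (s : seq E),
  [/\ (map_poly phi p).[x] = 0,
      injective psi,
      map_poly psi p = \prod_(a <- s) ('X - a%:P),
      forall a, a \in s -> integralOver psi a
    & forall q a, a \in s -> root (map_poly psi q) a -> (map_poly phi q).[x] = 0].
Proof.
move=> int_x.
have [kappa kappaE] := fraction_lift (@tofrac_inj R) phi_inj (valuation_fraction valR).
have kmap q : map_poly kappa (map_poly tofrac q) = map_poly phi q.
  by rewrite -map_poly_comp; apply: eq_map_poly.
have [f mon_f /rootP fx] := int_x.
have [|p [mon_p px p_min]] := @minimal_polynomial K F kappa x.
  exists (map_poly tofrac f); last by rewrite kmap; exact/rootP.
  by rewrite map_poly_eq0_id0 ?tofrac_eq0 ?lead_coef_eq0 monic_neq0.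
have [E [chi [s pE]]] := splitting_extension mon_p.
pose psi : {rmorphism R -> E} := chi \o tofrac.
have psi_inj : injective psi by move=> a b /fmorph_inj/tofrac_inj.
have cmap q : map_poly chi (map_poly tofrac q) = map_poly psi q.
  by rewrite -map_poly_comp.
have p_root a : (a \in s) = root (map_poly chi p) a by rewrite pE root_prod_XsubC.
have pf : p %| map_poly tofrac f.
  apply/eqP; apply: p_min; last by rewrite ltn_modp monic_neq0.
  have := fx; rewrite -kmap {1}(divp_eq (map_poly tofrac f) p) rmorphD rmorphM.
  by rewrite hornerD hornerM px mulr0 add0r.
have int_s a : a \in s -> integralOver psi a.
  rewrite p_root => pa; exists f => //; rewrite -cmap.
  by have /dvdpP[d ->] := pf; rewrite rmorphM rootM pa orbT.
have coef_int i : exists c, p`_i = tofrac c.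
  apply: (valuation_normal valR).
  have : integralOver psi (map_poly chi p)`_i.
    rewrite pE.
    have : \prod_(a <- s) ('X - a%:P) \is a polyOver (is_integral psi).
      rewrite big_seq; apply: rpred_prod => a sa; rewrite polyOverXsubC.
      exact/asboolP/int_s.
    by move=> /polyOverP/(_ i)/asboolP.
  rewrite coef_map => -[g mon_g]; rewrite -cmap fmorph_root => gp.
  by exists g.
have [c cE] := choice coef_int.
pose P := \poly_(i < size p) c i.
have PE : map_poly tofrac P = p.
  apply/polyP => i; rewrite coef_map coef_poly; case: ltnP => [_|le_pi].
    exact/esym/cE.
  by rewrite nth_default // rmorph0.
exists P, E, psi, s; split=> //.
- by rewrite -kmap PE.
- by rewrite -cmap PE.
move=> q a; rewrite p_root => pa; rewrite -cmap -kmap.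
exact: minimal_polynomial_conj mon_p px p_min pa.
Qed.

Lemma integral_local (x : F) : integralOver phi x ->
  (exists y, integralOver phi y /\ x * y = 1) \/
  (exists y, integralOver phi y /\ (1 - x) * y = 1).
Proof.
move=> int_x.
have [P [E [psi [s [Px psi_inj PE int_s conj_s]]]]] := integral_minimal_polynomial int_x.
have mon_P : P \is monic.
  rewrite monicE; apply/eqP/psi_inj; rewrite -lead_coef_map_inj ?rmorph0 // PE rmorph1.
  exact/eqP/monic_prod_XsubC.
set n := size s.
have [m [unit_m lift_m]] := hensel_root valR henR.
have [kk [tau [tauE _]]] := residue_field_ex m.
have mon_tP : map_poly tau P \is monic by exact: monic_map.
have [E' [theta [s' thE]]] := splitting_extension mon_tP.
pose sigma : {rmorphism R -> E'} := theta \o tau.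
have sigmaE a : (sigma a == 0) = (a \in spec_pred m) by rewrite fmorph_eq0 tauE.
have sPE : map_poly sigma P = \prod_(a <- s') ('X - a%:P).
  by rewrite -thE -map_poly_comp.
have sz_s' : size s' = n.
  apply: succn_inj; rewrite -(size_prod_XsubC s' id) -sPE -(size_prod_XsubC s id) -PE.
  by rewrite !size_map_poly_id0 // (monicP mon_P) rmorph1 oner_neq0.
pose alpha (i : 'I_n) := s`_i; pose gamma (i : 'I_n) := s'`_i.
have aE : map_poly psi P = \prod_i ('X - (alpha i)%:P).
  by rewrite PE (big_nth 0) big_mkord.
have gE : map_poly sigma P = \prod_i ('X - (gamma i)%:P).
  by rewrite sPE (big_nth 0) big_mkord sz_s'.
pose I0 := [set i | gamma i != 0]; set r := #|I0|.
have gE' : map_poly sigma P = (\prod_(i in I0) ('X - (gamma i)%:P)) * 'X^(n - r).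
  rewrite gE (bigID (mem I0)) /=; congr (_ * _).
  rewrite (eq_bigr (fun=> 'X)) => [|i]; last first.
    by rewrite inE negbK => /eqP->; rewrite subr0.
  rewrite prodr_const; congr ('X^_).
  have := cardC I0; rewrite card_ord => /(congr1 (subn^~ r)); rewrite addKn => <-.
  by apply: eq_card => i; rewrite !inE.
have [r0|r_gt0] := posnP r.
  (* Modulo [m] the polynomial [P] is a power of ['X], so [P.[1]] is a unit of R. *)
  right; have := @integral_unit_of_root _ _ phi x P 1 int_x; rewrite rmorph1; apply=> //.
  apply: unit_m; rewrite -sigmaE -horner_map rmorph1 gE' (cards0_eq r0) big_set0.
  by rewrite mul1r hornerXn expr1n oner_neq0.
left.
have [H HE] := SymmetricFunctions.subset_products n r P.
have mon_H : H \is monic.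
  rewrite monicE; apply/eqP/psi_inj; rewrite -lead_coef_map_inj ?rmorph0 // (HE _ _ _ aE).
  rewrite rmorph1; exact/eqP/monic_prod_XsubC.
pose g := \prod_(i in I0) gamma i.
have g_neq0 : g != 0 by apply/prodf_neq0 => i; rewrite inE.
(* An r-subset other than [I0] contains the index of a zero root, so modulo [m] all roots of [H]
   vanish except [g], which is simple. *)
have [N sHE] : exists N, map_poly sigma H = ('X - g%:P) * 'X^N.
  rewrite (HE _ _ _ gE) (bigD1 I0) //=; eexists; congr (_ * _).
  rewrite (eq_bigr (fun=> 'X)) => [|I /andP[/eqP cardI neI]].
    exact: prodr_const.
  rewrite (_ : \prod_(i in I) gamma i = 0) ?subr0 //.
  have /subsetPn[i iI] : ~~ (I \subset I0).
    apply: contra neI => sub; by rewrite eqEcard sub cardI leqnn.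
  by rewrite inE negbK => /eqP gi0; rewrite (bigD1 i) //= gi0 mul0r.
(* Up to sign, [g] is the lowest nonzero coefficient of [P] modulo [m], so it has a representative
   in R, as lifting requires. *)
pose c0 := (-1) ^+ r * P`_(n - r).
have sc0 : sigma c0 = g.
  rewrite rmorphM rmorphXn rmorphN1 -coef_map gE' coefMXn ltnn subnn.
  rewrite -horner_coef0 horner_prod.
  rewrite (eq_bigr (fun i => - gamma i)) => [|i _]; last by rewrite hornerXsubC sub0r.
  by rewrite prodrN mulrA -exprMn mulrNN mulr1 expr1n mul1r.
have [||b [Hb bc0]] := lift_m H c0 mon_H.
- by rewrite -sigmaE -horner_map sHE sc0 hornerM hornerXsubC subrr mul0r.
- rewrite -sigmaE -horner_map -deriv_map sHE sc0 derivM derivXsubC mul1r.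
  by rewrite hornerD hornerM hornerXsubC subrr mul0r addr0 hornerXn expf_neq0.
have [b' bb'] : exists b', b * b' = 1.
  have sb : sigma b = sigma c0 by apply/eqP; rewrite -subr_eq0 -rmorphB sigmaE.
  by apply: unit_m; rewrite -sigmaE sb sc0.
(* The root [b] of [H] is a product of r conjugates of [x]; since [b] is a unit and r is positive,
   some conjugate has an integral inverse. *)
have : (map_poly psi H).[psi b] == 0 by apply/eqP; rewrite horner_map Hb rmorph0.
rewrite (HE _ _ _ aE) horner_prod => /prodf_eq0[I /eqP cardI].
rewrite hornerXsubC subr_eq0 => /eqP bE.
have [i iI] : exists i, i \in I by apply/card_gt0P; rewrite cardI.
have alpha_s j : alpha j \in s by rewrite mem_nth.
pose y := (\prod_(j in I | j != i) alpha j) * psi b'.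
have ay : alpha i * y = 1.
  by rewrite mulrA -(bigD1 i) //= -bE -rmorphM bb' rmorph1.
have int_y : integralOver psi y.
  apply: integral_mul; last exact: integral_id.
  by apply: integral_prod => j _; exact: int_s.
(* The inverse of [alpha i] lies in [E], not in [F]. Reversing its equation gives a relation over R
   at [alpha i], which also holds at [x]; its constant term 1 makes [x] invertible. *)
have [q [q0 qa]] := integral_inverse_root ay int_y.
have qx : (map_poly phi q).[x] = 0 by apply: conj_s (alpha_s i) _; exact/rootP.
have [|y' [int_y' xy']] := @integral_unit_of_root _ _ phi x q 0 int_x _ qx.
  by exists 1; rewrite q0 mulr1.
exists (- y'); split; first exact: integral_opp.
by rewrite mulrN -mulNr -[- x]add0r -(rmorph0 phi).
Qed.

End HenselValuation.

Lemma integral_trans (A B C : comNzRingType) (f : {rmorphism A -> B})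
    (g : {rmorphism B -> C}) x :
  (forall b, integralOver f b) -> integralOver g x -> integralOver (g \o f) x.
Proof.
move=> int_f [p mon_p px].
apply: (integral_root_monic (p := map_poly g p)) => //; first exact: monic_map.
apply/integral_poly => i; rewrite coef_map; exact: integral_rmorph.
Qed.

(** * The integral closure in a field: a fraction or its inverse is integral *)

Section ValuationExtension.
Variable R : idomainType.
Hypotheses (valR : valuation_ring R) (henR : henselian R).
Local Notation K := {fraction R}.
Local Notation tofrac := (@FracField.tofrac R).

Lemma common_denominator (n : nat) (c : 'I_n -> K) :
  exists s (b : 'I_n -> R), s != 0 /\ forall i, c i * tofrac s = tofrac (b i).
Proof.
have [a] := choice (fun i => valuation_fraction valR (c i)).
move=> /choice[s sP]; exists (\prod_i s i).
exists (fun i => a i * \prod_(j | j != i) s j); split=> [|i].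
  by apply/prodf_neq0 => i _; have [+ _] := sP i; rewrite tofrac_eq0.
have [si_neq0 ->] := sP i.
by rewrite (bigD1 i) //= !tofracM mulrA divfK.
Qed.

Variables (F : fieldType) (phi : {rmorphism R -> F}).
Hypothesis phi_inj : injective phi.
Let integral := integralOver phi.

Lemma integral_fraction_root (a s : F) : s != 0 -> integral a -> integral s ->
  exists p : {poly R}, p != 0 /\ (map_poly phi p).[a / s] = 0.
Proof.
move=> s_neq0 int_a int_s.
have [kappa kappaE] := fraction_lift (@tofrac_inj R) phi_inj (valuation_fraction valR).
have int_alg x : integral x -> algebraicOver kappa x.
  move=> [p mon_p px]; exists (map_poly tofrac p); first by rewrite monic_neq0 ?monic_map.
  by rewrite -map_poly_comp (eq_map_poly kappaE).
have [p p_neq0 /rootP pz] := algebraic_div (int_alg a int_a) (int_alg s int_s).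
have [d [b [d_neq0 bE]]] := common_denominator (fun i : 'I_(size p) => p`_i).
pose q := \poly_(i < size p) (if insub i is Some j then b j else 0).
have qE : map_poly tofrac q = tofrac d *: p.
  apply/polyP => i; rewrite coef_map coefZ coef_poly; case: ltnP => [lt_ip|le_pi].
    by rewrite insubT -[RHS]mulrC; exact: (esym (bE (Sub i lt_ip))).
  by rewrite (nth_default _ le_pi) mulr0; exact: tofrac0.
exists q; split.
  apply: contra_neq p_neq0 => q0; move: qE; rewrite q0 rmorph0 => /esym/eqP.
  by rewrite scaler_eq0 tofrac_eq0 (negPf d_neq0) => /eqP.
rewrite -(eq_map_poly kappaE) (map_poly_comp kappa tofrac) qE map_polyZ hornerZ.
by rewrite pz mulr0.
Qed.

(** With [a] the coefficient of degree [n.+1], multiplying the equation by [a ^+ n] makes it monic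
    in [a * z]. *)
Lemma integral_lead_mul (p : {poly F}) (n : nat) (z : F) :
  (size p <= n.+2)%N -> (forall i, integral p`_i) -> p.[z] = 0 ->
  integral (p`_n.+1 * z).
Proof.
move=> sz_p int_p pz; set a := p`_n.+1.
pose q := \poly_(i < n.+1) (p`_i * a ^+ (n - i)).
have sz_q : (size q < size ('X^(n.+1) : {poly F})%R)%N.
  by rewrite size_polyXn ltnS size_poly.
apply: (integral_root_monic (p := 'X^(n.+1) + q)).
- by rewrite monicE lead_coefDl // lead_coefXn.
- rewrite /root hornerD hornerXn horner_poly.
  apply/eqP; transitivity (a ^+ n * p.[z]); last by rewrite pz mulr0.
  rewrite (horner_coef_wide _ sz_p) [in RHS]big_ord_recr /= mulrDr addrC mulr_sumr; congr (_ + _).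
    apply: eq_bigr => i _; have le_in : (i <= n)%N by rewrite -ltnS.
    rewrite -[X in _ = a ^+ X * _](subnK le_in) exprD exprMn; ring.
  by rewrite -/a exprMn exprSr; ring.
apply/integral_poly => i; rewrite coefD coefXn coef_poly; apply: integral_add.
  exact: integral_nat.
case: ifP => _; last exact: integral0.
apply: integral_mul; first exact: int_p.
elim: (n - i)%N => [|k IHk]; first by rewrite expr0; exact: integral1.
by rewrite exprS; apply: integral_mul IHk; exact: int_p.
Qed.

Let unit x := exists y, integral y /\ x * y = 1.

(** Locality applied to [- b / u]: either it is invertible, and so is [b], or [1 + b / u] is, and so
    is [u + b]. *)
Lemma integral_unit_add (u b : F) : unit u -> integral u -> integral b ->
  unit (u + b) \/ unit b.
Proof.
move=> [v [int_v uv]] int_u int_b.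
have int_x : integral (- b * v) by apply: integral_mul => //; exact: integral_opp.
have [[y [int_y xy]]|[y [int_y xy]]] := integral_local valR henR phi_inj int_x.
  right; exists (- (v * y)); split; first by apply/integral_opp/integral_mul.
  by rewrite -xy; ring.
left; exists (v * y); split; first exact: integral_mul.
by rewrite -xy -uv; ring.
Qed.

(** Induction on the degree: the top term [a * z ^+ n.+1] is absorbed into the next one as
    [b * z ^+ n], where [b = a * z] is integral. A unit coefficient can be lost in two ways only: it
    was [a], and then [z = b / a] is integral; or it was the next one, and then locality makes [b] a
    unit, so that [a / b] is the inverse of [z]. *)
Lemma integral_or_inverse_aux (n : nat) (p : {poly F}) (z : F) :
  (size p <= n)%N -> (forall i, integral p`_i) -> (exists i, unit p`_i) ->
  p.[z] = 0 -> integral z \/ integral z^-1.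
Proof.
have unit_neq0 x : unit x -> x != 0.
  by move=> [y [_]] /eqP; apply: contraTneq => ->; rewrite mul0r eq_sym oner_neq0.
elim: n p => [|[|n] IHn] p sz_p int_p [i ui] pz.
- move: sz_p; rewrite size_poly_leq0 => /eqP p0.
  by move: (unit_neq0 _ ui); rewrite p0 coef0 eqxx.
- move: pz; rewrite (size1_polyC sz_p) hornerC => p0.
  move: (unit_neq0 _ ui); rewrite (size1_polyC sz_p) p0 polyC0 coef0 eqxx //.
set a := p`_n.+1; set b := a * z.
have int_b : integral b by exact: integral_lead_mul.
pose p' := \poly_(j < n.+1) (p`_j + (if j == n then b else 0)).
have p'z : p'.[z] = 0.
  rewrite -pz (horner_coef_wide z sz_p) horner_poly !big_ord_recr /= eqxx -/a.
  rewrite mulrDl /b exprS addrA; congr (_ + _); last by ring.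
  congr (_ + _); apply: eq_bigr => j _.
  by rewrite (ltn_eqF (ltn_ord j)) addr0.
have int_p' j : integral p'`_j.
  rewrite coef_poly; case: ifP => _; last exact: integral0.
  apply: integral_add (int_p j) _; case: ifP => _; [exact: int_b | exact: integral0].
have [up'|nup'] := pselect (exists j, unit p'`_j).
  exact: IHn (size_poly _ _) int_p' up' p'z.
have [lt_in|gt_in|i_n] := ltngtP i n.
- case: nup'; exists i; rewrite coef_poly ltnS (ltnW lt_in).
  by rewrite (ltn_eqF lt_in) addr0.
- have i_n1 : i = n.+1.
    apply/eqP; rewrite eqn_leq gt_in andbT -ltnS; apply: leq_trans sz_p.
    by rewrite ltnNge; apply: contraTN (unit_neq0 _ ui) => le_pi; rewrite nth_default ?eqxx.
  left; move: ui; rewrite i_n1 -/a => -[v [int_v av]].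
  by rewrite -[z]mul1r -av mulrAC -/b; exact: integral_mul.
have ub : unit b.
  have [] := integral_unit_add ui (int_p i) int_b; last by [].
  move=> uib; case: nup'; exists n.
  by rewrite coef_poly ltnSn eqxx -i_n.
have [v [int_v bv]] := ub; right.
have z_neq0 : z != 0 by apply: contraTneq (unit_neq0 _ ub) => z0; rewrite /b z0 mulr0 eqxx.
rewrite (_ : z^-1 = a * v); first exact: integral_mul (int_p _) int_v.
by apply: (mulfI z_neq0); rewrite mulfV // -bv /b; ring.
Qed.

(** The fraction is a root of a polynomial over R; dividing this polynomial by its largest
    coefficient makes one coefficient equal to 1. *)
Lemma integral_or_inverse (a s : F) : s != 0 -> integral a -> integral s ->
  integral (a / s) \/ integral (a / s)^-1.
Proof.
move=> s_neq0 int_a int_s.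
have [p [p_neq0 pz]] := integral_fraction_root s_neq0 int_a int_s.
have [|i [d [pi_neq0 dE]]] := @valuation_min R valR (size p) (fun i => p`_i).
  have lt_p : ((size p).-1 < size p)%N by rewrite prednK // size_poly_gt0.
  by exists (Ordinal lt_p); rewrite -lead_coefE lead_coef_eq0.
pose q := \poly_(j < size p) (if insub j is Some j' then d j' else 0).
have pE : p = p`_i *: q.
  apply/polyP => j; rewrite coefZ coef_poly; case: ltnP => [lt_jp|le_pj].
    by rewrite insubT; exact: (dE (Sub j lt_jp)).
  by rewrite nth_default // mulr0.
apply: (@integral_or_inverse_aux (size q) (map_poly phi q)).
- by rewrite size_poly.
- by move=> j; rewrite coef_map; exact: integral_id.
- exists i, 1; split; first exact: integral1.
  rewrite mulr1 coef_map coef_poly ltn_ord valK.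
  by rewrite -(rmorph1 phi); congr (phi _); apply: (mulfI pi_neq0); rewrite -dE mulr1.
have /eqP := pz; rewrite pE map_polyZ hornerZ mulf_eq0 => /orP[|/eqP //].
by rewrite -(rmorph0 phi) (inj_eq phi_inj) (negPf pi_neq0).
Qed.

End ValuationExtension.

(** * Spectra of integral extensions *)

Lemma spec_pred0 (B : comNzRingType) (q : spec B) : 0 \in spec_pred q.
Proof. by case: (spec_idealr q). Qed.

Lemma spec_pred1 (B : comNzRingType) (q : spec B) : 1 \notin spec_pred q.
Proof. by case: (spec_idealr q). Qed.

Lemma spec_predD (B : comNzRingType) (q : spec B) x y :
  x \in spec_pred q -> y \in spec_pred q -> x + y \in spec_pred q.
Proof. by move=> qx qy; rewrite -[x]mul1r; case: (spec_idealr q) => _ _; apply. Qed.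

Lemma spec_predMl (B : comNzRingType) (q : spec B) a x :
  x \in spec_pred q -> a * x \in spec_pred q.
Proof.
by move=> qx; rewrite -[_ * _]addr0; case: (spec_idealr q) => q0 _; apply.
Qed.

Lemma spec_predB (B : comNzRingType) (q : spec B) x y :
  x \in spec_pred q -> y \in spec_pred q -> x - y \in spec_pred q.
Proof. by move=> qx qy; rewrite -mulN1r spec_predD ?spec_predMl. Qed.

Lemma spec_predM (B : comNzRingType) (q : spec B) x y :
  (x * y \in spec_pred q) = (x \in spec_pred q) || (y \in spec_pred q).
Proof.
apply/idP/orP => [/spec_prime/orP //|[qx|]]; last exact: spec_predMl.
by rewrite mulrC spec_predMl.
Qed.

Lemma spec_predX (B : comNzRingType) (q : spec B) x n :
  x ^+ n \in spec_pred q -> x \in spec_pred q.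
Proof.
elim: n => [|n IHn]; first by rewrite expr0 (negPf (spec_pred1 q)).
by rewrite exprS spec_predM => /orP[//|/IHn].
Qed.

Lemma spec_eq (B : comNzRingType) (p q : spec B) :
  {subset spec_pred p <= spec_pred q} -> {subset spec_pred q <= spec_pred p} ->
  p = q.
Proof. by move=> pq qp; apply: spec_inj => x; apply/idP/idP; [exact: pq | exact: qp]. Qed.

Lemma spec_mapE (A B : comNzRingType) (f : {rmorphism A -> B}) (q : spec B) a :
  (a \in spec_pred (spec_map f q)) = (f a \in spec_pred q).
Proof. by []. Qed.

(** Take [q] maximal among the ideals disjoint from the image of the complement of [p]. If [a] in
    [p] had its image outside [q], maximality would give [f s = y + c * f a] with [y] in [q] and [s]
    outside [p]; an integral equation of [c] then forces a power of [s] into [p]. *)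
Lemma lying_over (A B : comNzRingType) (f : {rmorphism A -> B}) (p : spec A) :
  injective f -> (forall b, integralOver f b) -> exists q : spec B, spec_map f q = p.
Proof.
move=> f_inj int_f.
have [||||x ->|q [_ qS q_max]] := @prime_avoiding B
  (fun x => exists2 a, a \notin spec_pred p & x = f a) (fun x => x = 0).
- by exists 1; rewrite ?spec_pred1 ?rmorph1.
- move=> _ _ [a pa ->] [b pb ->]; exists (a * b); last by rewrite rmorphM.
  by rewrite spec_predM negb_or pa.
- by [].
- by move=> a u v -> ->; rewrite mulr0 addr0.
- move=> [a pa]; rewrite -(rmorph0 f) => /f_inj a0.
  by rewrite -a0 spec_pred0 in pa.
have sub a : f a \in spec_pred q -> a \in spec_pred p.
  by move=> /qS fa; apply: contrapT => /negP pa; apply: fa; exists a.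
exists q; apply: spec_eq => a; rewrite spec_mapE; first exact: sub.
move=> pa; apply: contrapT => /negP /q_max[y [c [qy [s ps sE]]]].
have [P mon_P /rootP Pc] := int_f c.
have sz_P : size P = (size P).-1.+1 by rewrite prednK // size_poly_gt0 monic_neq0.
set n := (size P).-1 in sz_P.
(* The equation of [c] rescaled to one of [c * f a]. Its coefficients below the leading 1 are
   multiples of [a], so its value at [s] is [s ^+ n] modulo [p]. *)
pose P' := \sum_(i < n.+1) (P`_i * a ^+ (n - i)) *: 'X^i.
have P'0 : (map_poly f P').[c * f a] = 0.
  have : f a ^+ n * (map_poly f P).[c] = 0 by rewrite Pc mulr0.
  rewrite (@horner_coef_wide _ n.+1) -?sz_P ?size_poly // => e; rewrite -[RHS]e.
  rewrite sz_P mulr_sumr rmorph_sum horner_sum; apply: eq_bigr => i _ /=.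
  rewrite map_polyZ map_polyXn hornerZ hornerXn coef_map rmorphM rmorphXn exprMn.
  have le_in : (i <= n)%N by rewrite -ltnS.
  by rewrite -[X in f a ^+ X * (_ * _)](subnK le_in) exprD; ring.
have [d dE] := horner_sub_dvd (map_poly f P') (f s) (c * f a).
have /sub : f P'.[s] \in spec_pred q.
  rewrite -horner_map -[_.[_]]subr0 -P'0 dE -sE addrK mulrC.
  exact: spec_predMl.
rewrite horner_sum big_ord_recr /= subnn expr0 mulr1 hornerZ hornerXn.
have -> : P`_n = 1 by exact/eqP.
rewrite mul1r => Ps; case/negP: ps; apply: (@spec_predX _ _ _ n).
have : \sum_(i < n) ((P`_i * a ^+ (n - i)) *: 'X^i).[s] \in spec_pred p.
  elim/big_ind: _ => [||i _]; [exact: spec_pred0 | exact: spec_predD |].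
  rewrite hornerZ hornerXn -(subnSK (ltn_ord i)) exprS.
  by rewrite !spec_predM pa orbT.
by move=> /(spec_predB Ps); rewrite addrAC subrr add0r.
Qed.

(** For stripping constant terms in inductions on monic polynomials: a constant mapped into a prime
    ideal cannot be the leading 1. *)
Lemma monic_MXaddC (A B : comNzRingType) (f : {rmorphism A -> B}) (q : spec B)
    (p : {poly A}) (c : A) :
  f c \in spec_pred q -> p * 'X + c%:P \is monic -> p \is monic.
Proof.
move=> qc; have [->|p_neq0] := eqVneq p 0.
  move=> /monicP; rewrite mul0r add0r lead_coefC => c1.
  by rewrite c1 rmorph1 (negPf (spec_pred1 q)) in qc.
rewrite !monicE lead_coefDl ?lead_coefMX // size_polyC size_mulX // ltnS.
by apply: leq_trans (leq_b1 _) _; rewrite size_poly_gt0.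
Qed.

(** Induct on a monic polynomial whose value at [x] lies in [q1]. Its constant term maps into [q2],
    hence into [q1]; once it is removed, either [x] is in [q1] or the quotient by ['X] has the same
    property. *)
Lemma integral_incomparable (A B : comNzRingType) (f : {rmorphism A -> B})
    (q1 q2 : spec B) (x : B) :
  integralOver f x -> {subset spec_pred q1 <= spec_pred q2} ->
  (forall a, f a \in spec_pred q2 -> f a \in spec_pred q1) ->
  x \in spec_pred q2 -> x \in spec_pred q1.
Proof.
move=> [P mon_P /rootP Px] sub12 sub21 q2x.
have : (map_poly f P).[x] \in spec_pred q1 by rewrite Px spec_pred0.
elim/poly_ind: P mon_P {Px} => [|p c IHp] mon_P.
  by rewrite monicE lead_coef0 eq_sym oner_eq0 in mon_P.
rewrite rmorphD rmorphM /= map_polyX map_polyC hornerMXaddC => q1v.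
have q1c : f c \in spec_pred q1.
  apply: sub21; have := spec_predB (sub12 _ q1v) (spec_predMl (map_poly f p).[x] q2x).
  by rewrite addrC addKr.
have mon_p := monic_MXaddC q1c mon_P.
have := spec_predB q1v q1c; rewrite addrK spec_predM => /orP[|//].
exact: IHp.
Qed.

Section ValuationOver.
Variables (R A N : comNzRingType) (g : {rmorphism R -> A}) (f : {rmorphism A -> N}).
Hypothesis f_inj : injective f.
Hypothesis int_N : forall x : N, integralOver (f \o g) x.
Hypothesis dvd_N : forall x y : N, (exists c, y = x * c) \/ (exists c, x = y * c).

Lemma spec_chain (q1 q2 : spec N) :
  {subset spec_pred q1 <= spec_pred q2} \/ {subset spec_pred q2 <= spec_pred q1}.
Proof.
have [|nsub] := pselect {subset spec_pred q1 <= spec_pred q2}; first by left.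
right=> y q2y; apply: contrapT => nq1y; apply: nsub => x q1x.
have [[c yE]|[c ->]] := dvd_N x y; last by rewrite mulrC spec_predMl.
by case: nq1y; rewrite yE mulrC spec_predMl.
Qed.

Lemma spec_over_uniq (q1 q2 : spec N) :
  (forall r, (f (g r) \in spec_pred q1) = (f (g r) \in spec_pred q2)) -> q1 = q2.
Proof.
move=> e; have [sub|sub] := spec_chain q1 q2; apply: spec_eq => //.
  by move=> x; apply: (integral_incomparable (int_N x)) => // r; rewrite e.
by move=> x; apply: (integral_incomparable (int_N x)) => // r; rewrite e.
Qed.

(** Bijectivity combines lying over with the uniqueness of primes above R. For the inverse to be
    continuous, each [b] outside a prime of N must divide the image of an element of R outside that
    prime. *)
Lemma spec_map_homeomorphism : homeomorphism (spec_map f).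
Proof.
have int_f x : integralOver f x.
  have [p mon_p px] := int_N x; exists (map_poly g p); first exact: monic_map.
  by rewrite -map_poly_comp.
have [k kK] := choice (fun p => lying_over p f_inj int_f).
have Kk : cancel (spec_map f) k.
  move=> q; apply: spec_over_uniq => r; rewrite -(spec_mapE f) kK.
  exact: spec_mapE.
exists k; split=> //; apply/continuousP => U [E ->].
  exists [set x | exists2 a, E a & x = f a]%classic; apply/seteqP; split=> q /=.
    by move=> [a Ea qa]; exists (f a) => //; exists a.
  by move=> [_ [a Ea ->] qa]; exists a.
exists [set a | exists2 b, E b & exists c, f a = b * c]%classic.
apply/seteqP; split=> p /=; last first.
  move=> [a [b Eb [c fa]] pa]; exists b => //; apply: contra pa => kb.
  by rewrite -(kK p) spec_mapE fa mulrC spec_predMl.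
move=> [b Eb kb].
suff [r [c rE] kr] : exists2 r, exists c, f (g r) = b * c & f (g r) \notin spec_pred (k p).
  by exists (g r); [exists b => //; exists c | rewrite -(kK p) spec_mapE].
(* Elements of the prime are multiples of [b]. In an integral equation of [b], constant terms inside
   the prime are stripped one by one and the factor [b] is cancelled; the first constant term
   outside the prime is the required multiple of [b]. *)
have dvd_b x : x \in spec_pred (k p) -> exists c, x = b * c.
  move=> kx; have [//|[c e]] := dvd_N b x.
  by case/negP: kb; rewrite e mulrC spec_predMl.
have [P mon_P /rootP Pb] := int_N b.
have : (map_poly (f \o g) P).[b] \in spec_pred (k p) by rewrite Pb spec_pred0.
elim/poly_ind: P mon_P {Pb} => [|Q c IHQ] mon_Q.
  by rewrite monicE lead_coef0 eq_sym oner_eq0 in mon_Q.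
rewrite rmorphD rmorphM /= map_polyX map_polyC hornerMXaddC /= => kv.
have [kc|nkc] := boolP (f (g c) \in spec_pred (k p)); last first.
  have [d e] := dvd_b _ kv; exists c => //; exists (d - (map_poly (f \o g) Q).[b]).
  by rewrite mulrBr -e; ring.
apply: IHQ; first exact: (monic_MXaddC (f := f \o g) kc mon_Q).
by have := spec_predB kv kc; rewrite addrK spec_predM (negPf kb) orbF.
Qed.

End ValuationOver.

(** * Residue fields and normalisation *)

Lemma residue_field_map_bijective (A B : comNzRingType) (f : {rmorphism A -> B})
    (q : spec B) :
  (forall x, exists r c, f r \notin spec_pred q /\ f r * x - f c \in spec_pred q) ->
  bijective (@residue_field_map A B f q).
Proof.
move=> approx; set p := spec_map f q.
have map_inj : injective (@residue_ring_map A B f q).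
  move=> x y /eqP; rewrite -subr_eq0 -rmorphB => /eqP/residue_ring_map_eq0/eqP.
  by rewrite subr_eq0 => /eqP.
have reg (C : comNzRingType) (r : spec C) x :
    x \notin spec_pred r -> GRing.lreg (\pi_(residue_ring r) x).
  move=> rx; apply: domain_lreg; first exact: ideal_quot_domain.
  by rewrite pi_eq0.
apply: inj_surj_bijective => [x y|z].
  have [a [s [reg_s ->]]] := tfrac_ex x; have [b [t [reg_t ->]]] := tfrac_ex y.
  rewrite /residue_field_map !total_fractions_mapE => /tfrac_eqP.
  by rewrite -!rmorphM => /map_inj e; apply/tfrac_eqP.
have [x [s [reg_s ->]]] := tfrac_ex z.
elim/quotW: x => x; elim/quotW: s reg_s => s reg_s.
have qs : s \notin spec_pred q by have := lreg_neq0 reg_s; rewrite pi_eq0.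
have [r [c [qr rx]]] := approx x; have [r' [c' [qr' rs]]] := approx s.
have qc' : f c' \notin spec_pred q.
  apply/negP => /(spec_predD rs); rewrite subrK spec_predM.
  by rewrite (negPf qr') (negPf qs).
have prc : r * c' \notin spec_pred p by rewrite spec_mapE rmorphM spec_predM negb_or qr.
(* Modulo [q], [x] is [c / r] and [s] is [c' / r'], so [x / s] is [c * r'] over [r * c']. *)
exists (tfrac (\pi_(residue_ring p) (c * r')) (reg _ _ _ prc)).
rewrite /residue_field_map total_fractions_mapE; apply/tfrac_eqP.
pose pq : {rmorphism B -> residue_ring q} := \pi_(residue_ring q).
transitivity (pq (f (c * r')) * pq s).
  by congr (_ * _); exact: residue_ring_mapE.
transitivity (pq x * pq (f (r * c'))); last first.
  by congr (_ * _); exact/esym/residue_ring_mapE.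
apply/eqP; rewrite -!rmorphM -subr_eq0 -rmorphB pi_eq0.
have -> : f (c * r') * s - x * f (r * c') =
    f c * (f r' * s - f c') - f c' * (f r * x - f c) by rewrite !rmorphM; ring.
by rewrite rpredB // spec_predMl.
Qed.

(** The nilradical of a domain is zero, so the normalisation consists of the elements of the
    fraction field that are integral over A. *)
Lemma normalisation_fractions (A : comNzRingType) : domain_axiom A ->
  exists (F : fieldType) (j : {rmorphism normalisation A -> F}),
    let h := j \o @to_normalisation A in
  [/\ injective j, injective (@to_normalisation A),
      forall x, integralOver h (j x),
      forall z, integralOver h z -> exists x, z = j x
    & forall z, exists a s, h s != 0 /\ z = h a / h s].
Proof.
move=> domA.
have nil0 a : (a \in nilradical A) = (a == 0).
  apply/asboolP/eqP => [[n]|->]; last by exists 1%N; rewrite expr1.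
  elim: n => [/eqP|n IHn]; first by rewrite expr0 oner_eq0.
  by rewrite exprS => /domA[//|/IHn].
pose pi : {rmorphism A -> reduced_ring A} := \pi_(reduced_ring A).
have pi_eq0' a : (pi a == 0) = (a == 0) by rewrite pi_eq0 nil0.
have dom_red : domain_axiom (reduced_ring A).
  elim/quotW => a; elim/quotW => b /eqP.
  rewrite -[X in X == _](rmorphM pi) pi_eq0' => /eqP/domA[]->; [left|right]; exact: (rmorph0 pi).
have [F [h0 bij_h0]] := total_fractions_field dom_red.
have h0_inj := bij_inj bij_h0; have [k0 _ hK0] := bij_h0.
pose j : {rmorphism normalisation A -> F} := h0 \o val.
exists F, j => h.
have hE a : h a = h0 (to_total_fractions (pi a)) by [].
have j_inj : injective j by move=> x y /h0_inj/val_inj.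
have T_inj : injective (@to_total_fractions (reduced_ring A)).
  by move=> x y /tfrac_eqP; rewrite !mulr1.
have h_eq0 a : (h a == 0) = (a == 0).
  rewrite hE -(rmorph0 h0) (inj_eq h0_inj).
  by rewrite -(rmorph0 (@to_total_fractions _)) (inj_eq T_inj) pi_eq0'.
split=> //.
- move=> a b /(congr1 j) /eqP; rewrite -[_ == _]/(h a == h b) -subr_eq0 -rmorphB h_eq0.
  by rewrite subr_eq0 => /eqP.
- move=> x; have /asboolP int_x := valP x.
  have := integral_rmorph h0 int_x.
  apply: (@integral_trans _ _ _ pi (h0 \o @to_total_fractions _)).
  by elim/quotW => b; exact: (integral_id pi).
- move=> z [p mon_p /rootP pz].
  suff int_z : integralOver (@to_total_fractions (reduced_ring A)) (k0 z).
    by exists (exist _ (k0 z) (introT (asboolP _) int_z)); rewrite /= hK0.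
  exists (map_poly pi p); first exact: monic_map.
  apply/rootP/h0_inj; rewrite -horner_map hK0 rmorph0 -pz.
  by rewrite -!map_poly_comp.
move=> z; have [a [s [reg_s kz]]] := tfrac_ex (k0 z).
elim/quotW: a kz => a; elim/quotW: s reg_s => s reg_s kz.
have s0 : h s != 0 by rewrite h_eq0 -pi_eq0'; exact: lreg_neq0.
exists a, s; split=> //; apply: (mulIf s0); rewrite divfK // -[z]hK0 !hE -rmorphM.
congr (h0 _); rewrite kz -[LHS]/(tmul _ _) tmulE.
by apply/tfrac_eqP; rewrite !mulr1 mulrC.
Qed.

(** In the fraction field, [x / y] or its inverse is integral over R, hence belongs to the
    normalisation. *)
Lemma normalisation_dvd (R : idomainType) (A : comNzRingType) (g : {rmorphism R -> A}) :
  valuation_ring R -> henselian R -> domain_axiom A -> injective g ->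
  (forall a, integralOver g a) ->
  [/\ injective (@to_normalisation A),
      forall x, integralOver (@to_normalisation A \o g) x
    & forall x y : normalisation A, (exists c, y = x * c) \/ (exists c, x = y * c)].
Proof.
move=> valR henR domA g_inj int_A.
have [F [j [j_inj f_inj int_j j_surj jfrac]]] := normalisation_fractions domA.
set f := @to_normalisation A; pose phi : {rmorphism R -> F} := j \o (f \o g).
have phi_inj : injective phi by move=> a b /j_inj/f_inj/g_inj.
have int_phi x : integralOver phi (j x).
  exact: (@integral_trans _ _ _ g (j \o f)) (int_j x).
have phi_j z : integralOver phi z -> exists x, z = j x.
  move=> [p mon_p pz]; apply: j_surj; exists (map_poly g p); first exact: monic_map.
  by rewrite -map_poly_comp.
split=> // [x|x y].
  have [p mon_p /rootP px] := int_phi x; exists p => //.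
  by apply/rootP/j_inj; rewrite -horner_map -map_poly_comp px rmorph0.
have [->|x0] := eqVneq x 0; first by right; exists 0; rewrite mulr0.
have [->|y0] := eqVneq y 0; first by left; exists 0; rewrite mulr0.
have j_neq0 u : u != 0 -> j u != 0 by rewrite -(rmorph0 j) (inj_eq j_inj).
have [/phi_j[c e]|/phi_j[c e]] :=
    integral_or_inverse valR henR phi_inj (j_neq0 _ y0) (int_phi x) (int_phi y).
  by right; exists c; apply: j_inj; rewrite rmorphM -e mulrC divfK ?j_neq0.
left; exists c; apply: j_inj; apply/esym.
by rewrite rmorphM -e invf_div mulrC divfK ?(j_neq0 _ x0).
Qed.

(** * Flatness and finiteness *)

Section TensorPure.
Variables (R : comNzRingType) (M N : lmodType R).

Definition pure (m : M) (n : N) : tensor M N := \pi_(tensor M N) [:: (m, n)].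

Lemma pi_tensor_cat (s t : seq (M * N)) :
  \pi_(tensor M N) (s ++ t) = \pi_(tensor M N) s + \pi_(tensor M N) t.
Proof. by rewrite -[RHS]/(tensor_add _ _) tensor_addE. Qed.

Lemma pi_tensor_sum (s : seq (M * N)) :
  \pi_(tensor M N) s = \sum_(x <- s) pure x.1 x.2.
Proof.
elim: s => [|[m n] s IHs]; first by rewrite big_nil.
by rewrite big_cons -IHs -cat1s pi_tensor_cat.
Qed.

Lemma pureDl n : {morph pure^~ n : m m' / m + m'}.
Proof. by move=> m m'; rewrite -pi_tensor_cat; apply/tensor_relP; exact: tensor_addl. Qed.

Lemma pureDr m : {morph pure m : n n' / n + n'}.
Proof. by move=> n n'; rewrite -pi_tensor_cat; apply/tensor_relP; exact: tensor_addr. Qed.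

Lemma pure0l n : pure 0 n = 0.
Proof. by apply/tensor_relP; exact: tensor_zero. Qed.

Lemma pureZ a m n : pure (a *: m) n = pure m (a *: n).
Proof. by apply/tensor_relP; exact: tensor_scale. Qed.

Lemma pure0r m : pure m 0 = 0.
Proof. by rewrite -(scale0r 0) -pureZ scale0r pure0l. Qed.

Lemma pure_sumr m (I : Type) (s : seq I) (F : I -> N) :
  pure m (\sum_(i <- s) F i) = \sum_(i <- s) pure m (F i).
Proof. by apply: (big_morph _ (pureDr m) (pure0r m)). Qed.

Lemma pure_suml n (I : Type) (s : seq I) (F : I -> M) :
  pure (\sum_(i <- s) F i) n = \sum_(i <- s) pure (F i) n.
Proof. by apply: (big_morph _ (pureDl n) (pure0l n)). Qed.

Lemma tensor_rel_sum (P : zmodType) (b : M -> N -> P) :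
  (forall m m' n, b (m + m') n = b m n + b m' n) ->
  (forall m n n', b m (n + n') = b m n + b m n') ->
  (forall a m n, b (a *: m) n = b m (a *: n)) ->
  forall s t, tensor_rel s t -> \sum_(x <- s) b x.1 x.2 = \sum_(x <- t) b x.1 x.2.
Proof.
move=> bDl bDr bZ s t; elim=> {s t}.
- by [].
- by move=> s t _ ->.
- by move=> s t u _ -> _ ->.
- by move=> s s' t t' _ e _ e'; rewrite !big_cat e e'.
- by move=> s t; rewrite !big_cat /= addrC.
- by move=> m m' n; rewrite !big_cons !big_nil /= bDl !addr0.
- by move=> m n n'; rewrite !big_cons !big_nil /= bDr !addr0.
- by move=> a m n; rewrite !big_cons !big_nil /= bZ.
move=> n; rewrite big_cons !big_nil /= addr0.
by apply: (addrI (b 0 n)); rewrite -bDl !addr0.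
Qed.

End TensorPure.

Lemma tensor_map_pure (R : comNzRingType) (M M' N : lmodType R) (f : {linear M -> M'})
    (m : M) (n : N) : tensor_map f (pure m n) = pure (f m) n.
Proof. exact: tensor_mapE. Qed.

(** If a nonzero [r] kills 1 in A, then multiplication by [r], injective on R, sends the tensor of 1
    and 1 to zero. By flatness this tensor comes from the zero module, here row vectors of length 0,
    and scalar multiplication then gives 1 = 0 in A. *)
Lemma faithfully_flat_in_alg_inj (R : idomainType) (A : comAlgType R) :
  faithfully_flat A -> injective (in_alg A).
Proof.
move=> ffA; apply: raddf_inj => r /= rA; apply: contrapT => /eqP r_neq0.
pose f : {linear 'rV[R]_0 -> R^o} := \0.
pose g : {linear R^o -> R^o} := r \*: idfun.
have fg : exact_seq f g.
  move=> y; split=> [/eqP|[x <-]]; last by rewrite /= scaler0.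
  by rewrite /= mulf_eq0 (negPf r_neq0) => /eqP ->; exists 0.
have /(_ (pure (1 : R^o) (1 : A)))[+ _] := (ffA _ _ _ f g).1 fg.
rewrite tensor_map_pure /= pureZ rA pure0r => /(_ erefl)[x].
elim/quotW: x => s; rewrite tensor_mapE => /tensor_relP.
have bZ (a b : R) (x : A) : (a * b) *: x = b *: (a *: x) by rewrite scalerA mulrC.
have bD (a b : R) (x : A) : (a + b) *: x = a *: x + b *: x by exact: scalerDl.
move=> /(tensor_rel_sum (b := fun (a : R^o) (x : A) => (a : R) *: x) bD (@scalerDr R A) bZ).
rewrite big_seq1 /= scale1r big_map big1 => [/esym/eqP|x _]; first by rewrite oner_eq0.
exact: scale0r.
Qed.

Section FreeFlat.
Variables (R : comNzRingType) (A : lmodType R) (n : nat) (e : 'I_n -> A)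
  (coord : 'I_n -> {linear A -> R^o}).
Hypothesis e_span : forall x, x = \sum_i coord i x *: e i.
Hypothesis coord_e : forall i j, coord i (e j) = (i == j)%:R.

Section Coordinates.
Variable N : lmodType R.

(** The component at [e i] under the isomorphism of [tensor N A] with n copies of N. *)
Definition tensor_coord (i : 'I_n) (t : tensor N A) : N :=
  \sum_(x <- repr t) coord i x.2 *: x.1.

Lemma tensor_coordE i s :
  tensor_coord i (\pi_(tensor N A) s) = \sum_(x <- s) coord i x.2 *: x.1.
Proof.
apply: (tensor_rel_sum (b := fun m a => coord i a *: m)); last exact: repr_tensor.
- by move=> m m' a; rewrite scalerDr.
- by move=> m a a'; rewrite linearD scalerDl.
- by move=> r m a; rewrite scalerA linearZ mulrC.
Qed.

Lemma tensor_coord0 i : tensor_coord i 0 = 0.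
Proof. by rewrite -[0 in LHS]/(\pi_(tensor N A) [::]) tensor_coordE big_nil. Qed.

Lemma tensor_coord_pure i m j : tensor_coord i (pure m (e j)) = (i == j)%:R *: m.
Proof. by rewrite tensor_coordE big_seq1 /= coord_e. Qed.

Lemma tensor_coord_sum (t : tensor N A) : t = \sum_i pure (tensor_coord i t) (e i).
Proof.
elim/quotW: t => s; rewrite pi_tensor_sum.
under [RHS]eq_bigr => i _ do rewrite -pi_tensor_sum tensor_coordE pure_suml.
rewrite exchange_big /=; apply: eq_bigr => x _.
rewrite {1}(e_span x.2) pure_sumr; apply: eq_bigr => i _.
by rewrite pureZ.
Qed.

End Coordinates.

Lemma tensor_coord_map (N N' : lmodType R) (f : {linear N -> N'}) i (t : tensor N A) :
  tensor_coord i (tensor_map f t) = f (tensor_coord i t).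
Proof.
elim/quotW: t => s; rewrite tensor_mapE !tensor_coordE big_map linear_sum.
by apply: eq_bigr => x _; rewrite linearZ.
Qed.

(** Tensoring with a free module takes copies, so exactness is checked coordinate by coordinate. The
    index [i0] makes the rank positive, and exactness is read back from that coordinate. *)
Lemma free_faithfully_flat (i0 : 'I_n) : faithfully_flat A.
Proof.
move=> N1 N2 N3 f g; split=> ex y.
  split=> [gy|[x <-]].
    have /choice[x xE] i : exists x, f x = tensor_coord i y.
      by apply/ex; rewrite -tensor_coord_map gy tensor_coord0.
    exists (\sum_i pure (x i) (e i)); rewrite linear_sum [RHS]tensor_coord_sum.
    by apply: eq_bigr => i _; rewrite -xE; exact: tensor_map_pure.
  rewrite [LHS]tensor_coord_sum big1 // => i _; rewrite !tensor_coord_map.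
  by rewrite (_ : g _ = 0) ?pure0l //; apply/ex; eexists.
have coord_pure (N : lmodType R) (m : N) : tensor_coord i0 (pure m (e i0)) = m.
  by rewrite tensor_coord_pure eqxx scale1r.
split=> [gy|[x <-]].
  have [|x xE] := (ex (pure y (e i0))).1; first by rewrite tensor_map_pure gy pure0l.
  by exists (tensor_coord i0 x); rewrite -tensor_coord_map xE.
have gf := (ex (pure (f x) (e i0))).2; rewrite (tensor_map_pure g) in gf.
rewrite -[LHS]coord_pure gf ?tensor_coord0 //.
by exists (pure x (e i0)); exact: tensor_map_pure.
Qed.

End FreeFlat.

(** A generating family of least size is a basis: dividing a relation by its largest coefficient,
    which torsion-freeness allows, writes one generator in terms of the others. *)
Lemma torsion_free_basis (R : idomainType) (M : lmodType R) :
  valuation_ring R -> finite_module M ->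
  (forall (a : R) (x : M), a *: x = 0 -> a = 0 \/ x = 0) ->
  exists (n : nat) (e : 'I_n -> M) (coord : 'I_n -> {linear M -> R^o}),
    (forall x, x = \sum_i coord i x *: e i) /\
    (forall i j, coord i (e j) = (i == j)%:R).
Proof.
move=> valR [n0 [e0 span0]] tf.
pose spans n := `[<exists e : 'I_n -> M, forall x, exists c, x = \sum_i c i *: e i>].
have ex_n : exists n, spans n by exists n0; apply/asboolP; exists e0.
case: (ex_minnP ex_n) => n /asboolP[e e_span] n_min.
have e_free (c : 'I_n -> R) : \sum_i c i *: e i = 0 -> forall i, c i = 0.
  move=> ce0 k; apply: contrapT => /eqP ck.
  have [|i [d [ci_neq0 dE]]] := valuation_min valR (c := c); first by exists k.
  have de0 : \sum_j d j *: e j = 0.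
    have [||//] := tf (c i) (\sum_j d j *: e j); last by move=> ci0; rewrite ci0 eqxx in ci_neq0.
    rewrite scaler_sumr -[RHS]ce0; apply: eq_bigr => j _.
    by rewrite scalerA -dE.
  have di1 : d i = 1 by apply: (mulfI ci_neq0); rewrite -dE mulr1.
  case: n => [|n] in e e_span n_min c ce0 k ck i d ci_neq0 dE de0 di1 *; first by case: i {ci_neq0 dE di1}.
  suff /n_min : spans n by rewrite ltnn.
  apply/asboolP; exists (e \o lift i) => x; have [b ->] := e_span x.
  exists (fun j => b (lift i j) - b i * d (lift i j)).
  have := de0; rewrite (bigD1_ord i) //= di1 scale1r => /eqP; rewrite addr_eq0 => /eqP ei.
  rewrite (bigD1_ord i) //= {1}ei scalerN scaler_sumr addrC -sumrB.
  by apply: eq_bigr => j _; rewrite scalerBl scalerA.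
have [c cE] := choice e_span.
have c_uniq x b : x = \sum_i b i *: e i -> forall i, c x i = b i.
  move=> xb i; apply/eqP; rewrite -subr_eq0; apply/eqP.
  apply: (e_free (fun i => c x i - b i)).
  by under eq_bigr => j _ do rewrite scalerBl; rewrite sumrB -cE -xb subrr.
have c_lin i : linear (fun x => c x i : R^o).
  move=> a x y; apply: (c_uniq _ (fun i => a * c x i + c y i)).
  under eq_bigr => j _ do rewrite scalerDl -scalerA.
  by rewrite big_split -scaler_sumr -!cE.
pose coord i : {linear M -> R^o} :=
  HB.pack (fun x => c x i : R^o) (GRing.isLinear.Build _ _ _ _ _ (c_lin i)).
exists n, e, coord; split=> [x|i j]; first exact: cE.
apply: (c_uniq _ (fun i => (i == j)%:R)).
rewrite (bigD1 j) //= eqxx scale1r big1 ?addr0 // => k /negPf->.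
by rewrite scale0r.
Qed.

(** Determinant trick: with M a matrix of multiplication by [x] on the generators, the determinant
    of [x - M] kills every generator, hence 1, and it is the characteristic polynomial of M at
    [x]. *)
Lemma finite_integral (B C : comNzRingType) (f : {rmorphism B -> C}) (n : nat)
    (e : 'I_n -> C) : (forall x, exists c, x = \sum_i f (c i) * e i) ->
  forall x, integralOver f x.
Proof.
move=> span x.
have [c cE] := choice (fun i => span (x * e i)).
pose M := \matrix_(i, j) c i j; pose v := \col_i e i.
pose D : 'M[C]_n := x%:M - map_mx f M.
have Dv : D *m v = 0.
  rewrite mulmxBl mul_scalar_mx; apply/eqP; rewrite subr_eq0; apply/eqP/colP => i.
  by rewrite !mxE cE; apply: eq_bigr => j _; rewrite !mxE.
have De i : \det D * e i = 0.
  have /(congr1 (mulmx (\adj D))) := Dv; rewrite mulmxA mul_adj_mx mulmx0 mul_scalar_mx.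
  by move=> /colP/(_ i); rewrite !mxE.
exists (char_poly M); first exact: char_poly_monic.
apply/rootP; rewrite -[LHS]mulr1; have [b ->] := span 1.
rewrite mulr_sumr big1 // => i _; rewrite mulrCA.
suff -> : (map_poly f (char_poly M)).[x] = \det D by rewrite De mulr0.
rewrite map_char_poly /char_poly -[LHS]/(horner_eval x _) -det_map_mx; congr (\det _).
apply/matrixP => k l; rewrite /char_poly_mx !mxE /=.
by rewrite /horner_eval hornerD hornerN hornerMn hornerX hornerC.
Qed.

(** * Finite subrings of a field *)

Section FiniteSubring.
Variables (R : comNzRingType) (L : comNzRingType) (rho : {rmorphism R -> L}).

(** Generators are indexed by any finite type, so that adjoining an element can index the new ones
    by pairs. *)
Definition finite_subring (V : L -> Prop) :=
  [/\ V 1, forall x y, V x -> V y -> V (x - y), forall x y, V x -> V y -> V (x * y)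
    & exists (I : finType) (e : I -> L),
        forall x, V x <-> exists c : I -> R, x = \sum_i rho (c i) * e i].

Lemma finite_subring0 V : finite_subring V -> V 0.
Proof. by move=> [V1 VB _ _]; rewrite -(subrr (1 : L)); exact: VB. Qed.

Lemma finite_subringD V x y : finite_subring V -> V x -> V y -> V (x + y).
Proof.
move=> finV Vx Vy; have [_ VB _ _] := finV; rewrite -[y]opprK; apply: (VB _ _ Vx).
by rewrite -sub0r; apply: VB => //; exact: finite_subring0.
Qed.

Lemma finite_subring_sum V (I : Type) (s : seq I) (P : pred I) (F : I -> L) :
  finite_subring V -> (forall i, P i -> V (F i)) -> V (\sum_(i <- s | P i) F i).
Proof.
move=> finV VF; elim/big_ind: _ => // [|x y]; first exact: finite_subring0.
exact: finite_subringD.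
Qed.

Lemma finite_subring_base V r : finite_subring V -> V (rho r).
Proof.
move=> [V1 _ _ [I [e VP]]]; apply/VP; have /VP[c c1] := V1.
exists (fun i => r * c i); rewrite -[LHS]mulr1 [in LHS]c1 mulr_sumr.
by apply: eq_bigr => i _; rewrite rmorphM mulrA.
Qed.

(** The ring of polynomial expressions in [s] over [V] is spanned by the generators of [V] times the
    powers of [s] below the degree of a monic equation of [s]. *)
Lemma finite_subring_adjoin V (s : L) : finite_subring V -> integralOver rho s ->
  exists V', [/\ finite_subring V', forall x, V x -> V' x & V' s].
Proof.
move=> finV [p mon_p /rootP ps]; have [V1 VB VM [I [e VP]]] := finV.
have V0 := finite_subring0 finV.
pose W x := exists q : {poly L}, (forall i, V q`_i) /\ x = q.[s].
set d := (size p).-1.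
have sz_p : size p = d.+1 by rewrite prednK // size_poly_gt0 monic_neq0.
have W_small n : forall q : {poly L}, (size q <= n)%N -> (forall i, V q`_i) ->
    exists q' : {poly L}, [/\ (size q' <= d)%N, forall i, V q'`_i & q.[s] = q'.[s]].
  elim: n => [|n IHn] q sz_q Vq.
    exists q; split=> //; exact: leq_trans sz_q _.
  have [sz_qd|lt_dq] := leqP (size q) d; first by exists q.
  have [sz_qn|lt_nq] := leqP (size q) n; first exact: IHn.
  have {sz_q lt_nq}sz_q : size q = n.+1 by apply/eqP; rewrite eqn_leq sz_q.
  have le_dn : (d <= n)%N by rewrite -ltnS -sz_q.
  (* One step of division by the monic [p]: the top coefficient cancels, the value at [s] is kept,
     and the coefficients stay in [V]. *)
  pose q1 := q - (q`_n *: 'X^(n - d)) * map_poly rho p.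
  have [||q' [sz_q' Vq' q1s]] := IHn q1.
  - have sz_q1 : (size q1 <= n.+1)%N.
      rewrite (leq_trans (size_polyD _ _)) // geq_max size_polyN sz_q leqnn /=.
      rewrite (leq_trans (size_polyMleq _ _)) //.
      apply: (@leq_trans ((n - d).+1 + d.+1).-1).
        rewrite -!subn1 leq_sub2r // leq_add //; last by rewrite -sz_p size_poly.
        by rewrite (leq_trans (size_scale_leq _ _)) // size_polyXn.
      by rewrite addSn /= addnS subnK.
    apply/leq_sizeP => j le_nj; move: le_nj; rewrite leq_eqVlt => /orP[/eqP<-|lt_nj].
      rewrite coefB -scalerAl coefZ coefXnM ltnNge leq_subr /= subKn // coef_map.
      have -> : p`_d = 1 by exact/eqP.
      by rewrite /= rmorph1 mulr1 subrr.
    by rewrite nth_default // (leq_trans sz_q1).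
  - move=> i; rewrite coefB; apply: VB => //; rewrite coefM; apply: finite_subring_sum => // k _.
    apply: VM; last by rewrite coef_map; exact: finite_subring_base.
    by rewrite coefZ coefXn; case: eqP => _; rewrite ?mulr1 ?mulr0.
  exists q'; split=> //; rewrite -q1s /q1 hornerD hornerN.
  have -> : ((q`_n *: 'X^(n - d)) * map_poly rho p).[s] = 0 by rewrite hornerM ps mulr0.
  by rewrite subr0.
exists W; split.
- split.
  + exists 1; split; last by rewrite hornerC.
    by move=> i; rewrite coef1; case: eqP.
  + move=> _ _ [q [Vq ->]] [q' [Vq' ->]]; exists (q - q').
    split; last by rewrite hornerD hornerN.
    by move=> i; rewrite coefB; exact: VB.
  + move=> _ _ [q [Vq ->]] [q' [Vq' ->]]; exists (q * q'); split; last by rewrite hornerM.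
    by move=> i; rewrite coefM; apply: finite_subring_sum => // k _; exact: VM.
  exists (I * 'I_d)%type, (fun ij : I * 'I_d => e ij.1 * s ^+ ij.2) => x; split.
    move=> [q0 [Vq0 ->]]; have [q [sz_q Vq ->]] := W_small _ q0 (leqnn _) Vq0.
    have [c cE] := choice (fun j : 'I_d => (VP q`_j).1 (Vq j)).
    exists (fun ij : I * 'I_d => c ij.2 ij.1).
    rewrite (horner_coef_wide _ sz_q) -(pair_bigA _ (fun i j => rho (c j i) * (e i * s ^+ j))).
    rewrite exchange_big; apply: eq_bigr => j _; rewrite cE mulr_suml.
    by apply: eq_bigr => i _; rewrite mulrA.
  move=> [c ->]; exists (\poly_(j < d) (if insub j is Some j' then \sum_i rho (c (i, j')) * e i else 0)).
  split=> [j|].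
    rewrite coef_poly; case: ifP => // lt_jd; rewrite insubT; apply/VP.
    by exists (fun i => c (i, Sub j lt_jd)).
  rewrite horner_poly (eq_bigr (fun ij => rho (c (ij.1, ij.2)) * (e ij.1 * s ^+ ij.2))) => [|[]//].
  rewrite -(pair_bigA _ (fun i j => rho (c (i, j)) * (e i * s ^+ j))) exchange_big.
  by apply: eq_bigr => j _; rewrite valK mulr_suml; apply: eq_bigr => i _; rewrite mulrA.
- move=> x Vx; exists x%:P; split; last by rewrite hornerC.
  by move=> i; rewrite coefC; case: eqP.
exists 'X; split; last by rewrite hornerX.
by move=> i; rewrite coefX; case: eqP.
Qed.

Lemma finite_subring_adjoin_seq V (s : seq L) : finite_subring V ->
  (forall x, x \in s -> integralOver rho x) ->
  exists V', [/\ finite_subring V', forall x, V x -> V' x & forall x, x \in s -> V' x].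
Proof.
move=> finV; elim: s => [|x s IHs] int_s; first by exists V.
have [|V1 [finV1 VV1 sV1]] := IHs; first by move=> y sy; apply: int_s; rewrite inE sy orbT.
have [|V2 [finV2 V12 V2x]] := @finite_subring_adjoin V1 x finV1.
  by apply: int_s; rewrite inE eqxx.
exists V2; split=> // [y /VV1 /V12 //|y]; rewrite inE => /orP[/eqP->//|/sV1/V12 //].
Qed.

Section Algebra.
Variables (V : L -> Prop) (finV : finite_subring V).

(* The proof argument keys the canonical instances below. *)
Definition finite_subring_mem (_ : finite_subring V) (x : L) : bool := `[<V x>].
Local Notation mem := (finite_subring_mem finV).

Lemma finite_subring_mem_closed : subring_closed mem.
Proof.
have [V1 VB VM _] := finV.
by split=> [|x y /asboolP Vx /asboolP Vy|x y /asboolP Vx /asboolP Vy]; apply/asboolP; auto.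
Qed.

HB.instance Definition _ :=
  GRing.isSubringClosed.Build L mem finite_subring_mem_closed.

Definition finite_subring_type := {x : L | mem x}.
Local Notation B := finite_subring_type.

HB.instance Definition _ := SubChoice.on B.
HB.instance Definition _ := [SubChoice_isSubComNzRing of B by <:].

Definition finite_subring_const (a : R) : B :=
  exist _ (rho a) (introT (asboolP _) (finite_subring_base a finV)).

Definition finite_subring_scale (a : R) (x : B) : B := finite_subring_const a * x.

Lemma finite_subring_scaleA a b x : finite_subring_scale a (finite_subring_scale b x) =
  finite_subring_scale (a * b) x.
Proof. by apply: val_inj; rewrite /= rmorphM mulrA. Qed.

Lemma finite_subring_scale1 : left_id 1 finite_subring_scale.
Proof. by move=> x; apply: val_inj; rewrite /= rmorph1 mul1r. Qed.

Lemma finite_subring_scaleDr : right_distributive finite_subring_scale +%R.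
Proof. by move=> a x y; apply: val_inj; rewrite /= mulrDr. Qed.

Lemma finite_subring_scaleDl x : {morph finite_subring_scale^~ x : a b / a + b}.
Proof. by move=> a b; apply: val_inj; rewrite /= rmorphD mulrDl. Qed.

HB.instance Definition _ := GRing.Zmodule_isLmodule.Build R B
  finite_subring_scaleA finite_subring_scale1 finite_subring_scaleDr
  finite_subring_scaleDl.

Lemma finite_subring_scaleAl (a : R) (x y : B) : a *: (x * y) = a *: x * y.
Proof. by apply: val_inj; rewrite /= mulrA. Qed.

HB.instance Definition _ :=
  GRing.Lmodule_isLalgebra.Build R B finite_subring_scaleAl.
HB.instance Definition _ := GRing.Lalgebra_isComAlgebra.Build R B.

End Algebra.

Lemma finite_subring_algebra V : finite_subring V ->
  exists (B : comAlgType R) (iota : {rmorphism B -> L}),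
  [/\ injective iota, forall x, V x <-> exists b, x = iota b,
      forall r, iota (in_alg B r) = rho r & finite_module B].
Proof.
move=> finV; pose B : comAlgType R := finite_subring_type finV.
pose iota : {rmorphism B -> L} := val.
have V_iota x : V x <-> exists b, x = iota b.
  split=> [Vx|[b ->]]; last by have /asboolP := valP b.
  by exists (exist _ x (introT (asboolP _) Vx)).
have iota_scale r b : iota (r *: b) = rho r * iota b by [].
exists B, iota; split=> //; first exact: val_inj.
  by move=> r; rewrite [in_alg B r]/= iota_scale rmorph1 mulr1.
have [_ _ _ [I [e VP]]] := finV.
have [i|b bE] := @choice I B (fun i b => e i = iota b).
  apply/V_iota/VP; exists (fun j => (j == i)%:R).
  rewrite (bigD1 i) //= eqxx rmorph1 mul1r big1 ?addr0 // => j /negPf->.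
  by rewrite rmorph0 mul0r.
exists #|I|, (fun k => b (enum_val k)) => x.
have [c cE] := (VP (iota x)).1 ((V_iota _).2 (ex_intro _ x erefl)).
exists (fun k => c (enum_val k)); apply: val_inj; rewrite [LHS]cE raddf_sum.
rewrite (reindex _ (onW_bij _ (@enum_val_bij I))) /=.
by apply: eq_bigr => k _; rewrite bE.
Qed.

End FiniteSubring.

(** * Residue extensions *)

(** The primes of a valuation ring are totally ordered, so distinct primes sort into a strict chain;
    dimension at most [d] allows [d.+1] of them. *)
Lemma finitely_many_primes (R : idomainType) :
  valuation_ring R -> finite_krull_dim R ->
  exists s : seq (spec R), forall p, p \in s.
Proof.
move=> valR [d dP].
pose le (p q : spec R) := `[<{subset spec_pred p <= spec_pred q}>].
have le_total : total le.
  move=> p q; apply/orP; have [|npq] := pselect {subset spec_pred p <= spec_pred q}.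
    by left; apply/asboolP.
  right; apply/asboolP => y qy; apply: contrapT => npy; apply: npq => x px.
  have [[c yE]|[c ->]] := valuation_dvd valR x y; last by rewrite mulrC spec_predMl.
  by case: npy; rewrite yE mulrC spec_predMl.
have le_trans : transitive le.
  move=> q p r /asboolP pq /asboolP qr; apply/asboolP => x; by move=> /pq/qr.
have bound (s : seq (spec R)) : uniq s -> (size s <= d.+1)%N.
  move=> us; case: (posnP (size s)) => [-> //|s_gt0].
  pose t := sort le s; have ut : uniq t by rewrite sort_uniq.
  have sz_t : size t = (size s).-1.+1 by rewrite size_sort prednK.
  have [p0 _] : exists p0 : spec R, p0 \in s by case: s s_gt0 {us t ut sz_t} => // p0 s _; exists p0; rewrite inE eqxx.
  rewrite -(prednK s_gt0) ltnS; apply: (dP _ (fun i => nth p0 t i)) => i j lt_ij.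
  have [lt_i lt_j] : (i < size t)%N /\ (j < size t)%N by rewrite sz_t !ltn_ord.
  split.
    apply/asboolP; apply: (sorted_ltn_nth le_trans) => //; exact: sort_sorted.
  by move=> /eqP; rewrite nth_uniq // => /eqP ij; rewrite ij ltnn in lt_ij.
pose P n := `[<exists s : seq (spec R), uniq s /\ size s = n>].
have exP : exists n, P n by exists 0%N; apply/asboolP; exists [::].
have [|n /asboolP[s [us sz_s]] n_max] := @ex_maxnP P d.+1 exP.
  by move=> n /asboolP[s [us <-]]; exact: bound.
exists s => p; apply: contrapT => /negP sp.
suff /n_max : P n.+1 by rewrite ltnn.
by apply/asboolP; exists (p :: s); rewrite /= sp us sz_s.
Qed.

Section ResidueFamilies.
Variable R : idomainType.
Hypothesis valR : valuation_ring R.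
Local Notation tofrac := (@FracField.tofrac R).

Lemma left_kernel (m n : nat) (C : 'M[R]_(m, n)) : (n < m)%N ->
  exists u : 'I_m -> R, (exists i, u i != 0) /\ forall j, \sum_i u i * C i j = 0.
Proof.
move=> lt_nm; pose D := map_mx tofrac C.
have /rowV0Pn[v /sub_kermxP vD v_neq0] : kermx D != 0.
  rewrite -mxrank_eq0 mxrank_ker subn_eq0 -ltnNge.
  by apply: leq_ltn_trans lt_nm; exact: rank_leq_col.
have [s [b [s_neq0 bE]]] := common_denominator valR (v 0).
exists b; split=> [|j].
  have /rV0Pn[i vi] := v_neq0; exists i.
  by rewrite -tofrac_eq0 -bE mulf_neq0 // tofrac_eq0.
apply: tofrac_inj; rewrite rmorph0 rmorph_sum.
have /rowP/(_ j) := vD; rewrite !mxE => e.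
transitivity ((\sum_i v 0 i * D i j) * tofrac s); last by rewrite e mul0r.
rewrite mulr_suml; apply: eq_bigr => i _.
by apply: etrans (tofracM _ _) _; rewrite -bE !mxE mulrAC.
Qed.

Variables (A : comAlgType R) (n : nat) (e : 'I_n -> A).
Hypothesis e_span : forall x, exists c, x = \sum_i c i *: e i.
Variables (L : fieldType) (psi : {rmorphism A -> L}).
Hypothesis L_frac : forall z, exists a s, psi s != 0 /\ z = psi a / psi s.
Hypothesis psi_inj : injective (psi \o in_alg A).
Let rho : {rmorphism R -> L} := psi \o in_alg A.

(** Over a common denominator the numerators lie in the image of A, which has n generators, so a
    matrix with more rows than columns gives the relation. *)
Lemma fraction_dependent (m : nat) (x : 'I_m -> L) : (n < m)%N ->
  exists u : 'I_m -> R, (exists i, u i != 0) /\ \sum_i rho (u i) * x i = 0.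
Proof.
move=> lt_nm; have [a] := choice (fun i => L_frac (x i)).
move=> /choice[s sP]; pose b i := a i * \prod_(j | j != i) s j.
pose S := \prod_i psi (s i).
have S_neq0 : S != 0 by apply/prodf_neq0 => i _; case: (sP i).
have bE i : psi (b i) = x i * S.
  have [si_neq0 ->] := sP i.
  by rewrite /b rmorphM rmorph_prod /S [in RHS](bigD1 i) //= mulrA divfK.
have [c cE] := choice (fun i => e_span (b i)).
have [u [u_neq0 uc]] := left_kernel (\matrix_(i, j) c i j) lt_nm.
exists u; split=> //; apply: (mulIf S_neq0); rewrite mul0r mulr_suml.
transitivity (psi (\sum_i u i *: b i)).
  rewrite rmorph_sum; apply: eq_bigr => i _.
  by rewrite -mulrA -bE /rho /= -rmorphM /= mulr_algl.
rewrite -(rmorph0 psi); congr (psi _).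
under eq_bigr => i _ do rewrite cE scaler_sumr.
rewrite exchange_big big1 //= => j _.
under eq_bigr => i _ do rewrite scalerA.
rewrite -scaler_suml -[X in X *: _]/(\sum_i u i * c i j).
have := uc j; under eq_bigr => i _ do rewrite mxE.
by move=> ->; rewrite scale0r.
Qed.

(** Take a longest family independent modulo [q]. Its length is at most n: a relation over R,
    divided by its largest coefficient, would have a coefficient 1, which is outside [q]. By
    maximality each [x] enters a relation modulo [q] with a coefficient outside [q]. *)
Lemma residue_family (O : comNzRingType) (tau : {rmorphism R -> O})
    (j : {rmorphism O -> L}) (q : spec O) :
  injective j -> (forall r, j (tau r) = rho r) ->
  exists s : seq O, forall x, exists r (c : 'I_(size s) -> R),
    tau r \notin spec_pred q /\ tau r * x - \sum_i tau (c i) * s`_i \in spec_pred q.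
Proof.
move=> j_inj j_tau.
pose indep (s : seq O) := forall c : 'I_(size s) -> R,
  \sum_i tau (c i) * s`_i \in spec_pred q -> forall i, tau (c i) \in spec_pred q.
pose P m := `[<exists s : seq O, indep s /\ size s = m>].
have exP : exists m, P m.
  by exists 0%N; apply/asboolP; exists [::]; split=> // c _ [].
have bound m : P m -> (m <= n)%N.
  move=> /asboolP[s [ind_s <-]]; rewrite leqNgt; apply/negP => lt_n.
  have [u [u_neq0 us]] := fraction_dependent (fun i => j s`_i) lt_n.
  have [i [d [ui_neq0 dE]]] := valuation_min valR u_neq0.
  have ds0 : \sum_k tau (d k) * s`_k = 0.
    apply: j_inj; rewrite rmorph0 rmorph_sum.
    have rho_ui : rho (u i) != 0 by rewrite -(rmorph0 rho) (inj_eq psi_inj).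
    apply: (mulfI rho_ui); rewrite mulr0; apply: etrans us; rewrite mulr_sumr.
    apply: eq_bigr => k _.
    by rewrite [j _](rmorphM j) j_tau (dE k) (rmorphM rho) mulrA.
  have := ind_s d; rewrite ds0 spec_pred0 => /(_ isT i).
  have -> : d i = 1 by apply: (mulfI ui_neq0); rewrite -dE mulr1.
  by rewrite rmorph1 (negPf (spec_pred1 q)).
have [m /asboolP[s [ind_s sz_s]] m_max] := ex_maxnP exP bound.
exists s => x; apply: contrapT => nx.
suff /m_max : P m.+1 by rewrite ltnn.
apply/asboolP; exists (x :: s); split; last by rewrite /= sz_s.
move=> c; rewrite big_ord_recl /= => qc.
have c0 : tau (c ord0) \in spec_pred q.
  apply: contrapT => /negP nc0; apply: nx; exists (c ord0), (fun i => - c (lift ord0 i)).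
  split=> //; rewrite -sumrN; under eq_bigr => i _ do rewrite rmorphN mulNr opprK.
  exact: qc.
move=> i; have [->//|[k ->]] : i = ord0 \/ exists k, i = lift ord0 k.
  by case: (unliftP ord0 i) => [k ->|->]; [right; exists k | left].
apply: (ind_s (fun k => c (lift ord0 k))).
have := spec_predB qc (spec_predMl x c0).
by rewrite [x * _]mulrC addrC addKr.
Qed.

End ResidueFamilies.

(** * Construction of the algebra *)

(** L is the residue field at a prime of A disjoint from the nonzero elements of R, hence above the
    zero ideal. *)
Lemma fraction_field_over (R : idomainType) (A : comAlgType R) :
  injective (in_alg A) ->
  exists (L : fieldType) (psi : {rmorphism A -> L}),
    injective (psi \o in_alg A) /\
    forall z, exists a s, psi s != 0 /\ z = psi a / psi s.
Proof.
move=> inj_A.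
have [||||x ->|q [_ qS _]] := @prime_avoiding A
  (fun x => exists2 r, r != 0 & x = in_alg A r) (fun x => x = 0).
- by exists 1; rewrite ?oner_neq0 ?rmorph1.
- move=> _ _ [r r0 ->] [s s0 ->]; exists (r * s); first by rewrite mulf_neq0.
  by rewrite rmorphM.
- by [].
- by move=> a u v -> ->; rewrite mulr0 addr0.
- by move=> [r r0]; rewrite -(rmorph0 (in_alg A)) => /inj_A e; rewrite -e eqxx in r0.
have [L [psi [psiE L_frac]]] := residue_field_ex q.
exists L, psi; split=> //; apply: raddf_inj => r /= /eqP; rewrite psiE => /qS qr.
by apply: contrapT => /eqP r0; apply: qr; exists r.
Qed.

Lemma integral_closure_ex (R L : comNzRingType) (rho : {rmorphism R -> L}) :
  exists (O : comNzRingType) (tau : {rmorphism R -> O}) (j : {rmorphism O -> L}),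
  [/\ injective j, forall r, j (tau r) = rho r, forall x, integralOver tau x
    & forall z, integralOver rho z <-> exists x, z = j x].
Proof.
pose O : comNzRingType := integral_closure rho.
pose tau : {rmorphism R -> O} := to_integral_closure rho.
pose j : {rmorphism O -> L} := val.
exists O, tau, j; split=> [||x|z]; [exact: val_inj | by [] | | split].
- have /asboolP[p mon_p /rootP px] := valP x; exists p => //; apply/rootP/val_inj.
  by rewrite -[val _]/(j _) -horner_map -map_poly_comp rmorph0.
- by move=> int_z; exists (exist _ z (introT (asboolP _) int_z)).
by move=> [x ->]; have /asboolP := valP x.
Qed.

Lemma rmorphism_factor (N O L : comNzRingType) (j : {rmorphism O -> L})
    (h : {rmorphism N -> L}) : injective j -> (forall x, exists y, h x = j y) ->
  exists k : {rmorphism N -> O}, forall x, j (k x) = h x.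
Proof.
move=> j_inj /choice[k0 k0E].
have k0B : zmod_morphism k0 by move=> x y; apply: j_inj; rewrite rmorphB -!k0E rmorphB.
have k0M : monoid_morphism k0.
  by split=> [|x y]; apply: j_inj; rewrite ?rmorphM -!k0E ?rmorph1 ?rmorphM.
pose k : {rmorphism N -> O} := HB.pack k0
  (GRing.isZmodMorphism.Build _ _ k0 k0B) (GRing.isMonoidMorphism.Build _ _ k0 k0M).
by exists k => x; rewrite -k0E.
Qed.

(* The residue data are transported from O to N along N -> O: a prime of N is
   determined by its trace on R. *)
Lemma residue_transfer (R : comNzRingType) (B N O : comNzRingType)
    (L : comNzRingType) (g : {rmorphism R -> B}) (f : {rmorphism B -> N})
    (h : {rmorphism N -> L}) (tau : {rmorphism R -> O}) (j : {rmorphism O -> L})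
    (q : spec N) (q' : spec O) (s : seq O) :
  (forall x, integralOver (f \o g) x) ->
  (forall x y : N, (exists c, y = x * c) \/ (exists c, x = y * c)) ->
  injective j -> (forall r, j (tau r) = h (f (g r))) ->
  (forall z, integralOver (j \o tau) z -> exists y, z = j y) ->
  spec_map tau q' = spec_map (f \o g) q ->
  (forall i : 'I_(size s), exists b, j s`_i = h (f b)) ->
  (forall x, exists r (c : 'I_(size s) -> R), tau r \notin spec_pred q' /\
      tau r * x - \sum_i tau (c i) * s`_i \in spec_pred q') ->
  forall x, exists r c, f r \notin spec_pred q /\ f r * x - f c \in spec_pred q.
Proof.
move=> int_N dvd_N j_inj j_tau j_surj q'q /choice[b bE] approx x.
have [k kE] : exists k : {rmorphism N -> O}, forall y, j (k y) = h y.
  apply: rmorphism_factor => // y; apply: j_surj.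
  have [p mon_p /rootP py] := int_N y; exists p => //; apply/rootP.
  rewrite -[RHS](rmorph0 h) -py -horner_map -map_poly_comp; congr (_.[_]).
  by apply: eq_map_poly => r; exact: j_tau.
have k_tau r : k (f (g r)) = tau r by apply: j_inj; rewrite kE j_tau.
have kq : spec_map k q' = q.
  apply: (spec_over_uniq int_N dvd_N) => r.
  by rewrite spec_mapE k_tau -(spec_mapE tau) q'q.
have [r [c [q'r rx]]] := approx (k x).
exists (g r), (\sum_i g (c i) * b i); rewrite -kq !spec_mapE rmorphB rmorphM k_tau.
split=> //; rewrite (_ : k (f _) = \sum_i tau (c i) * s`_i) //.
rewrite !rmorph_sum; apply: eq_bigr => i _; rewrite !rmorphM k_tau; congr (_ * _).
by apply: j_inj; rewrite kE bE.
Qed.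

Theorem lemma3 (R : idomainType) (A : comAlgType R) :
  valuation_ring R -> henselian R -> finite_krull_dim R ->
  finite_module A -> faithfully_flat A ->
  exists (A' : comAlgType R) (g : {lrmorphism A -> A'}),
    [/\ finite_module A', faithfully_flat A'
      & spec_residue_iso (@to_normalisation A')].
Proof.
move=> valR henR dimR [n [e e_span]] ffA.
have [L [psi [rho_inj L_frac]]] := fraction_field_over (faithfully_flat_in_alg_inj ffA).
pose rho : {rmorphism R -> L} := psi \o in_alg A.
have rho_alg r a : psi (r *: a) = rho r * psi a by rewrite -mulr_algl rmorphM.
have [O [tau [j [j_inj j_tau int_O O_int]]]] := integral_closure_ex rho.
have tau_inj : injective tau.
  by move=> r r' /(congr1 j); rewrite !j_tau => /rho_inj.
(* For each prime [p] of R, a prime of [O] above it and a family spanning its residue field over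
   that of [p]. *)
have fam p : exists (q : spec O) (s : seq O), spec_map tau q = p /\
    forall x, exists r (c : 'I_(size s) -> R), tau r \notin spec_pred q /\
      tau r * x - \sum_i tau (c i) * s`_i \in spec_pred q.
  have [q qp] := lying_over p tau_inj int_O.
  have [s sP] := @residue_family R valR A n e e_span L psi L_frac rho_inj O tau j q j_inj j_tau.
  by exists q, s.
have [qs] := choice fam; move=> /choice[ss fam_s].
have [ps psP] := finitely_many_primes valR dimR.
pose gens := [seq j x | x <- flatten [seq ss p | p <- ps]].
have fin_A : finite_subring rho (fun x => exists a, x = psi a).
  split.
  - by exists 1; rewrite rmorph1.
  - by move=> _ _ [a ->] [b ->]; exists (a - b); rewrite rmorphB.
  - by move=> _ _ [a ->] [b ->]; exists (a * b); rewrite rmorphM.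
  exists 'I_n, (psi \o e) => x; split=> [[a ->]|[c ->]].
    have [c ->] := e_span a; exists c; rewrite rmorph_sum.
    by apply: eq_bigr => i _; exact: rho_alg.
  exists (\sum_i c i *: e i); rewrite rmorph_sum.
  by apply: eq_bigr => i _; rewrite rho_alg.
have [|V [finV VA Vgens]] := @finite_subring_adjoin_seq _ _ rho _ gens fin_A.
  by move=> _ /mapP[x _ ->]; apply/O_int; exists x.
have [A' [iota [iota_inj VE iota_alg finA']]] := finite_subring_algebra finV.
have [g0 g0E] := choice (fun a => (VE (psi a)).1 (VA _ (ex_intro _ a erefl))).
have g0Z : linear g0.
  move=> r a b; apply: iota_inj.
  by rewrite -g0E rmorphD rho_alg -mulr_algl rmorphD rmorphM iota_alg -!g0E.
have g0M : monoid_morphism g0.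
  by split=> [|a b]; apply: iota_inj; rewrite -?g0E ?rmorph1 ?rmorphM -?g0E.
pose g : {lrmorphism A -> A'} := HB.pack g0
  (GRing.isLinear.Build _ _ _ _ g0 g0Z) (GRing.isMonoidMorphism.Build _ _ g0 g0M).
have iota0 x : (iota x == 0) = (x == 0) by rewrite -(rmorph0 iota) (inj_eq iota_inj).
have domA' : domain_axiom A'.
  move=> x y /(congr1 iota)/eqP; rewrite rmorphM rmorph0 mulf_eq0 !iota0.
  by move=> /orP[/eqP|/eqP]; [left | right].
have alg_inj : injective (in_alg A').
  by move=> r r' /(congr1 iota); rewrite !iota_alg => /rho_inj.
have tfA' (r : R) (x : A') : r *: x = 0 -> r = 0 \/ x = 0.
  rewrite -mulr_algl => /domA'[|->]; last by right.
  by rewrite -(rmorph0 (in_alg A')) => /alg_inj ->; left.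
have int_A' : forall a, integralOver (in_alg A') a.
  have [n' [e' e'_span]] := finA'; apply: (finite_integral (e := e')) => x.
  have [c ->] := e'_span x; exists c; apply: eq_bigr => i _.
  by rewrite mulr_algl.
exists A', g; split=> //.
  (* [A'] is free, being finite and torsion-free; its rank is positive because 1 is not 0 in
     [A']. *)
  have [n' [e' [coord [e'_span coord_e']]]] := torsion_free_basis valR finA' tfA'.
  case: n' => [|n'] in e' coord e'_span coord_e' *; last exact: free_faithfully_flat e'_span coord_e' ord0.
  by have := oner_neq0 A'; rewrite (e'_span 1) big_ord0 eqxx.
have [f_inj int_f dvd_f] := normalisation_dvd valR henR domA' alg_inj int_A'.
split; first exact: spec_map_homeomorphism f_inj int_f dvd_f.
move=> q; apply: residue_field_map_bijective => x.
have [F [j' [j'_inj _ int_j' _ F_frac]]] := normalisation_fractions domA'.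
have jf_inj : injective (j' \o @to_normalisation A') by move=> a b /j'_inj/f_inj.
(* [h] embeds the fraction field of [A'] into [L], where the normalisation of [A'] is compared with
   [O]. *)
have [h hE] := fraction_lift jf_inj iota_inj F_frac.
(* The family chosen for the trace of [q] on R lies in [A'] by construction, so it serves for the
   residue field at [q]. *)
have [qs_p fam_p] := fam_s (spec_map (@to_normalisation A' \o in_alg A') q).
apply: (residue_transfer (h := h \o j') int_f dvd_f j_inj _ _ qs_p _ fam_p) => [r|z [p mon_p pz]|i].
- by rewrite j_tau -iota_alg; exact/esym/hE.
- by apply/O_int; exists p => //; rewrite -(eq_map_poly j_tau).
have /VE[a aE] : V (j (ss (spec_map (@to_normalisation A' \o in_alg A') q))`_i).
  apply/Vgens/map_f/flattenP; eexists; first by apply: map_f; exact: psP.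
  exact: mem_nth.
by exists a; rewrite aE; exact/esym/hE.
Qed.
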